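(* Let $R$ be a smooth ruled surface in $\mathbb R^4$ parametrised by $F(u,t)=\mathbf x(u)+t\,\mathbf e(u)$, $u\in I$, $t\in\mathbb R$, with $0\in I$. Any point of $R$ is either a parabolic point or an inflection point of real type. In particular, if $\det\big([\mathbf x'(0)\ \mathbf e(0)\ \mathbf e'(0)\ \mathbf e''(0)]\big)\ne0$, then on the ruling $R_0$ all points are parabolic except one, which is an inflection point of real type.
   Context: Ruled surface: $I\subset\mathbb R$ is an open interval, $\mathbf x:I\to\mathbb R^4$ and $\mathbf e:I\to\mathbb R^4\setminus\{0\}$ are smooth, $R=F(I\times\mathbb R)$, and $R_u=\{\mathbf x(u)+t\mathbf e(u):t\in\mathbb R\}$ is the ruling at $u$. Standing assumption: only smooth points (where $F$ is immersive) and non-developable surfaces are considered, i.e. $\mathbf x'(u),\mathbf e(u),\mathbf e'(u)$ are linearly independent for every $u\in I$. Types of points: near a point $p$ of a surface, choose affine coordinates centred at $p$ in which the surface is the graph $(x,y)\mapsto(x,y,f^1(x,y),f^2(x,y))$ with $j^1f^i(0,0)=0$ (Monge form). Let the 2-jets of $f^1,f^2$ at the origin be $Q_1=lx^2+2mxy+ny^2$ and $Q_2=ax^2+2bxy+cy^2$, and put $$\delta(p)=(an-cl)^2-4(am-bl)(bn-cm),\quad K(p)=ac-b^2+ln-m^2,\quad A=\begin{pmatrix}a&b&c\\ l&m&n\end{pmatrix}.$$ The point $p$ is parabolic if $\delta(p)=0$, $K(p)<0$ and $\operatorname{rank}A=2$. It is an inflection point of real type if $\delta(p)=0$, $K(p)<0$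 and $\operatorname{rank}A=1$. *)

(* Defs.v *)
From HB Require Import structures.
From mathcomp Require Import all_boot all_order all_algebra.
From mathcomp Require Import all_classical all_reals all_analysis.

Set Implicit Arguments.
Unset Strict Implicit.
Unset Printing Implicit Defensive.

Import Order.TTheory GRing.Theory Num.Theory numFieldNormedType.Exports.

Local Open Scope classical_set_scope.
Local Open Scope ring_scope.

(* C^oo on the open set A: every iterated directional derivative
   'D_(v1) ('D_(v2) ... f) is (Frechet) differentiable, hence continuous,
   at every point of A. *)
Definition smooth_on (R : realType) (V W : normedModType R)
    (A : set V) (f : V -> W) : Prop :=
  forall (vs : seq V) (p : V), A p ->
    differentiable (foldr (fun (v : V) (g : V -> W) => 'D_v g) f vs) p.

Definition ruled (R : realType) (x e : R -> 'cV[R]_4) (q : R^o * R^o)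
  : 'cV[R]_4 := x q.1 + q.2 *: e q.1.

Definition det4 (R : realType) (a b c d : 'cV[R]_4) : R :=
  \det (row_mx a (row_mx b (row_mx c d)) : 'M[R]_4).

Section Monge.
Variable R : realType.
Implicit Types (f : R^o * R^o -> R^o) (F : R^o * R^o -> 'cV[R]_4).

Definition dX : R^o * R^o := (1, 0).
Definition dY : R^o * R^o := (0, 1).

Definition j1_zero f : Prop :=
  [/\ f (0, 0) = 0, 'D_dX f (0, 0) = 0 & 'D_dY f (0, 0) = 0].

(* [j2_quad f l m n]: the degree 2 part of the Taylor polynomial of f at the
   origin is l x^2 + 2 m x y + n y^2 (note the factor 1/2 in the Hessian). *)
Definition j2_quad f (l m n : R) : Prop :=
  [/\ l = 'D_dX ('D_dX f) (0, 0) / 2,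
      m = 'D_dX ('D_dY f) (0, 0) / 2
    & n = 'D_dY ('D_dY f) (0, 0) / 2].

Definition graph_pt f1 f2 (z : R^o * R^o) : 'cV[R]_4 :=
  \col_(i < 4) [:: z.1; z.2; f1 z; f2 z]`_i.

(* The surface is a parametrised one, F : D -> R^4, and "near p = F q0" means
   "the image of a neighbourhood of q0".  The affine coordinates centred at p
   are the w such that the point is p + B w, with B invertible. *)
Definition monge_form (D : set (R^o * R^o)) F (q0 : R^o * R^o)
    (B : 'M[R]_4) f1 f2 : Prop :=
  B \in unitmx /\
  exists U V : set (R^o * R^o),
    [/\ open U, U q0 & U `<=` D] /\
    [/\ open V, V (0, 0), smooth_on V f1 & smooth_on V f2] /\
    [/\ F @` U = (fun z => F q0 + B *m graph_pt f1 f2 z) @` V,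
        j1_zero f1 & j1_zero f2].

Definition delta (l m n a b c : R) : R :=
  (a * n - c * l) ^+ 2 - 4 * (a * m - b * l) * (b * n - c * m).

Definition curvK (l m n a b c : R) : R := a * c - b ^+ 2 + l * n - m ^+ 2.

Definition matA (l m n a b c : R) : 'M[R]_(2, 3) :=
  \matrix_(i < 2, j < 3) (nth [::] [:: [:: a; b; c]; [:: l; m; n]] i)`_j.

Definition point_type (r : nat) (D : set (R^o * R^o)) F (q0 : R^o * R^o)
    : Prop :=
  exists (B : 'M[R]_4) (f1 f2 : R^o * R^o -> R^o) (l m n a b c : R),
    [/\ monge_form D F q0 B f1 f2, j2_quad f1 l m n & j2_quad f2 a b c] /\
    [/\ delta l m n a b c = 0, curvK l m n a b c < 0
      & \rank (matA l m n a b c) = r].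

Definition parabolic := point_type 2.
Definition real_inflection := point_type 1.

End Monge.

(* Main.v *)
(* Let F(u,t) = x(u) + t e(u).  If G = B^-1 (F - p) are the coordinates in which
   the surface is the graph of (f1, f2), then G3 = f1(G1, G2) and G4 = f2(G1, G2)
   near q0, and since the 1-jets of f1 and f2 vanish, the Hessians satisfy
   Hess(G_k) = J^T Hess(f_k) J with J the Jacobian of (G1, G2).  As F is affine in
   t, Hess(G_k) = [[A_k, C_k], [C_k, 0]] where A_k and C_k are the k-th
   coordinates of F_uu and e'.  Hence delta = 0, K is a negative multiple of
   C_3^2 + C_4^2, and rank A = 2 iff A_3 C_4 <> A_4 C_3, that is, iff
   det(x', e, e', x'' + t e'') <> 0, for every Monge form; this determinant is
   affine in t.  A Monge form exists because (G1, G2) has a smooth local inverse: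
   eliminating t leaves one scalar equation for u, which is monotone in u. *)

Require Import Defs.
From mathcomp Require Import all_boot all_order all_algebra ring lra.
From mathcomp Require Import all_classical all_reals all_analysis.
Import Order.TTheory GRing.Theory Num.Theory numFieldNormedType.Exports.
Local Open Scope classical_set_scope.
Local Open Scope ring_scope.
Set Implicit Arguments.
Unset Strict Implicit.
Unset Printing Implicit Defensive.

(** [monge_form] equates two images and gives no change of parameters. None has to be built: the
    first two graph coordinates of a point are its parameters, so [F q] can only come from z = (G1
    q, G2 q). The Hessians are computed for an arbitrary Monge form, and this makes the two types
    exclusive. The vanishing of delta has a geometric reason: it is the resultant of the two
    quadratic forms, and both vanish in the direction of the ruling. The obstacle is the smoothness
    of the local inverse, since [smooth_on] speaks of all iterated derivatives. The root w of the
    scalar equation is obtained pointwise; the mean value theorem makes it Lipschitz, hence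
    differentiable. Its derivatives are rational expressions in z and smooth functions of w, and a
    class of differentiable functions that is closed under differentiation consists of smooth
    functions. *)

Lemma near_open {T : topologicalType} (A : set T) (P : T -> Prop) (p : T) :
  open A -> A p -> (forall q, A q -> P q) -> \forall q \near p, P q.
Proof. by move=> oA Ap AP; near=> q; apply: AP; near: q; exact: open_nbhs_nbhs.
Unshelve. all: by end_near. Qed.

(** * Smooth functions *)

Section smooth_calculus.
Variable R : realType.

(** This explicit estimate form makes differentiability visibly local and allows implicit
    differentiation by direct inequalities. *)
Lemma is_diffP (V W : normedModType R) (f : V -> W) (df : {linear V -> W})
    (p : V) : continuous df ->
  is_diff p f df <-> forall e, 0 < e ->
    \forall q \near p, `|f q - (f p + df (q - p))| <= e * `|q - p|.
Proof.
move=> cdf; split=> [[dfp E] e e0|H].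
  have [_ /eqaddoP /(_ e e0)] := (diff_locallyP p f).1 dfp.
  rewrite [X in _ -> X](near_shift 0 p) subr0; apply: filterS => h /=.
  by rewrite E !fctE /= addrK.
have Hf : f \o shift p = cst (f p) + df +o_ 0 id.
  apply/eqaddoP => e e0; have := H e e0.
  rewrite [X in X -> _](near_shift 0 p) subr0; apply: filterS => h /=.
  by rewrite !fctE /= addrK.
have E := diff_unique cdf Hf.
by apply: DiffDef => //; apply/diff_locallyP; rewrite E.
Qed.

Lemma near_eq_differentiable (V W : normedModType R) (f g : V -> W) (p : V) :
  (\near p, f p = g p) -> differentiable f p -> differentiable g p.
Proof.
move=> fg dfp; have cd := diff_continuous dfp.
suff [] : is_diff p g ('d f p) by [].
apply/is_diffP => // e e0.
have := (@is_diffP _ _ f _ p cd).1 (differentiableP dfp) e e0.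
rewrite (nbhs_singleton fg).
by apply: filterS2 fg => q ->.
Qed.

(* Coinduction principle: a class of differentiable functions that is stable,
   on A, under all directional derivatives consists of smooth functions. *)
Lemma smooth_on_coind (V W : normedModType R) (A : set V)
    (S : (V -> W) -> Prop) : open A ->
  (forall f, S f -> (forall p, A p -> differentiable f p) /\
     forall v, exists2 g, S g & forall p, A p -> 'D_v f p = g p) ->
  forall f, S f -> smooth_on A f.
Proof.
move=> oA HS f Sf vs p Ap.
suff [g Sg fg] : exists2 g, S g &
    forall p, A p -> foldr (fun v (g : V -> W) => 'D_v g) f vs p = g p.
  have [dg _] := HS _ Sg.
  apply: near_eq_differentiable (dg _ Ap).
  by apply: near_open oA Ap _ => // q Aq; rewrite fg.
elim: vs => [|v vs [g Sg fg]] /=; first by exists f.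
have [_ /(_ v) [h Sh gh]] := HS _ Sg.
exists h => // q Aq; rewrite -gh //; apply: near_eq_derive.
exact: near_open oA Aq _.
Qed.

(** On the line the direction 1 generates all others, so iterating [derive1] replaces the lists of
    directions of [smooth_on]. *)
Definition smooth1 (I : set R) (h : R -> R) : Prop :=
  forall n u, I u -> derivable (derive1n n h) u 1.

Lemma smooth1_derive1 I h : smooth1 I h -> smooth1 I (derive1 h).
Proof. by move=> sh n u Iu; rewrite -derive1Sn; exact: sh. Qed.

Lemma smooth_on_derivable (W : normedModType R) (I : set R) (f : R -> W) :
  smooth_on (I : set R^o) (f : R^o -> W) ->
  forall n u, I u -> derivable (derive1n n f) u 1.
Proof.
move=> sf n u Iu; apply/derivable1_diffP.
suff -> : derive1n n f = foldr (fun (v : R^o) (g : R^o -> W) => 'D_v g) f (nseq n 1).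
  exact: sf.
elim: n => [//|n IH]; rewrite derive1nS /= -IH.
by apply/funext => s; rewrite derive1E.
Qed.

Lemma is_derive_mulmx_entry (n m : nat) (M : 'M[R]_(m, n)) (f : R -> 'cV[R]_n)
    (i : 'I_m) u : derivable f u 1 ->
  is_derive u 1 (fun s => (M *m f s) i 0) ((M *m derive1 f u) i 0).
Proof.
move=> df.
have dfj j : derivable (fun s => f s j 0) u 1 by move/derivable_mxP: df; apply.
have -> : (fun s => (M *m f s) i 0) = \sum_j (M i j *: (fun s => f s j 0)).
  by apply/funext => s; rewrite mxE fct_sumE.
apply: is_derive_eq.
  by apply: is_derive_sum => j; apply: is_deriveZ; exact/derivableP.
by rewrite mxE; apply: eq_bigr => j _; rewrite derive1E derive_mx // mxE.
Qed.

Lemma derive1n_mulmx_entry (n m : nat) (M : 'M[R]_(m, n)) (I : set R)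
    (f : R -> 'cV[R]_n) (i : 'I_m) : open I ->
  smooth_on (I : set R^o) (f : R^o -> 'cV[R]_n) ->
  forall k u, I u ->
  derive1n k (fun s => (M *m f s) i 0) u = (M *m derive1n k f u) i 0.
Proof.
move=> oI sf; elim=> [//|k IH] u Iu.
rewrite derive1nS derive1E (@near_eq_derive _ _ _ _ (fun s => (M *m derive1n k f s) i 0)).
  by have [_ ->] := is_derive_mulmx_entry M i (@smooth_on_derivable _ _ _ sf k u Iu).
exact: near_open oI Iu _.
Qed.

Lemma smooth1_mulmx_entry (n m : nat) (M : 'M[R]_(m, n)) (I : set R)
    (f : R -> 'cV[R]_n) (i : 'I_m) : open I ->
  smooth_on (I : set R^o) (f : R^o -> 'cV[R]_n) ->
  smooth1 I (fun s => (M *m f s) i 0).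
Proof.
move=> oI sf k u Iu.
have [df _] := is_derive_mulmx_entry M i (@smooth_on_derivable _ _ _ sf k u Iu).
apply: near_eq_derivable df.
apply: (near_open oI Iu) => s Is; by rewrite (derive1n_mulmx_entry M i oI sf k Is).
Qed.

End smooth_calculus.

(** * Derivatives of scalar functions affine in the second variable *)

Section ruled_scalar.
Variable R : realType.
Implicit Types (I : set R) (a b h : R -> R) (q v w : R^o * R^o).

Lemma is_diff_comp1 (V : normedModType R) (g : V -> R^o) (dg : V -> R^o) h p :
  derivable h (g p) 1 -> is_diff p g dg ->
  is_diff p (fun z => h (g z) : R^o) (fun y => derive1 h (g p) * dg y).
Proof.
move=> dh dgp.
have dhp : is_diff (g p) (h : R^o -> R^o) (fun s => s * derive1 h (g p)).
  apply: DiffDef; first exact/derivable1_diffP.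
  by rewrite diff1E //; exact/derivable1_diffP.
apply: (is_diff_eq (is_diff_comp dgp dhp)).
by apply/funext => v /=; exact: mulrC.
Qed.

Lemma is_diff_fst (V W : normedModType R) (p : V * W) :
  is_diff p (fst : V * W -> V) fst.
Proof.
by apply: DiffDef; [apply: linear_differentiable|rewrite diff_lin//]; move=> z; exact: cvg_fst.
Qed.

Lemma is_diff_snd (V W : normedModType R) (p : V * W) :
  is_diff p (snd : V * W -> W) snd.
Proof.
by apply: DiffDef; [apply: linear_differentiable|rewrite diff_lin//]; move=> z; exact: cvg_snd.
Qed.

Lemma is_diff_ruled a b q : derivable a q.1 1 -> derivable b q.1 1 ->
  is_diff q (fun q => a q.1 + q.2 * b q.1 : R^o)
    (fun v => v.1 * (derive1 a q.1 + q.2 * derive1 b q.1) + v.2 * b q.1).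
Proof.
move=> da db.
have Da := is_diff_comp1 da (is_diff_fst q).
have Db := is_diff_comp1 db (is_diff_fst q).
apply: (is_diff_eq (is_diffD Da (is_diffM (is_diff_snd q) Db))).
apply/funext => v; rewrite !fctE /=.
rewrite /GRing.scale /=; ring.
Qed.

Lemma derive_ruled a b q v : derivable a q.1 1 -> derivable b q.1 1 ->
  'D_v (fun q => a q.1 + q.2 * b q.1 : R^o) q =
  v.1 * (derive1 a q.1 + q.2 * derive1 b q.1) + v.2 * b q.1.
Proof.
by move=> da db; have [d E] := is_diff_ruled da db; rewrite deriveE // E.
Qed.

Lemma derive2_ruled I a b q v w : open I -> smooth1 I a -> smooth1 I b -> I q.1 ->
  derivable ('D_v (fun q => a q.1 + q.2 * b q.1 : R^o)) q w /\
  'D_w ('D_v (fun q => a q.1 + q.2 * b q.1 : R^o)) q =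
    v.1 * w.1 * (derive1n 2 a q.1 + q.2 * derive1n 2 b q.1)
    + (v.1 * w.2 + v.2 * w.1) * derive1 b q.1.
Proof.
move=> oI sa sb Iq.
(* A directional derivative of a(s) + y b(s) has the same shape a1(s) + y b1(s), so the first-order
   formula applies a second time. *)
pose a1 s := v.1 * derive1 a s + v.2 * b s.
pose b1 s := v.1 * derive1 b s.
have Da1 s : I s -> is_derive s 1 a1 (v.1 * derive1n 2 a s + v.2 * derive1 b s).
  move=> Is.
  have := is_deriveD (is_deriveZ v.1 (derivableP (sa 1%N s Is)))
      (is_deriveZ v.2 (derivableP (sb 0%N s Is))).
  by rewrite -!derive1E.
have Db1 s : I s -> is_derive s 1 b1 (v.1 * derive1n 2 b s).
  move=> Is; have := is_deriveZ v.1 (derivableP (sb 1%N s Is)).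
  by rewrite -!derive1E.
have E : \forall q' \near q,
    a1 q'.1 + q'.2 * b1 q'.1 = 'D_v (fun q => a q.1 + q.2 * b q.1 : R^o) q'.
  have oJ : open [set q : R^o * R^o | I q.1].
    by apply: (open_comp _ oI) => z _; exact: cvg_fst.
  apply: (near_open oJ) => // q' Iq'.
  rewrite derive_ruled; [|exact: sa 0%N _ Iq'|exact: sb 0%N _ Iq'].
  by rewrite /a1 /b1; ring.
have [Da Ea] := Da1 _ Iq; have [Db Eb] := Db1 _ Iq.
split.
  apply: (near_eq_derivable E); apply: diff_derivable.
  by have [] := is_diff_ruled Da Db.
have {}Ea : derive1 a1 q.1 = v.1 * derive1n 2 a q.1 + v.2 * derive1 b q.1.
  by rewrite derive1E.
have {}Eb : derive1 b1 q.1 = v.1 * derive1n 2 b q.1 by rewrite derive1E.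
rewrite -(near_eq_derive _ E) derive_ruled // Ea Eb /b1.
by move: (derive1n 2 a _) (derive1n 2 b _) (derive1 b _) => A B C; ring.
Qed.

End ruled_scalar.

(** * First- and second-order chain rule in the plane *)

Section chain_rule.
Variable R : realType.
Implicit Types (f g : R^o * R^o -> R^o) (q v w : R^o * R^o).

Lemma linear_pairE (L : {linear (R^o * R^o)%type -> R^o}) (a b : R^o) :
  L (a, b) = a * L (dX R) + b * L (dY R).
Proof.
have -> : (a, b) = a *: dX R + b *: dY R.
  by congr pair; rewrite /= /GRing.scale /= ?mulr1 ?mulr0 ?addr0 ?add0r.
by rewrite linearD !linearZ.
Qed.

Lemma derive_comp_pair f (g1 g2 : R^o * R^o -> R^o) q v :
  differentiable g1 q -> differentiable g2 q -> differentiable f (g1 q, g2 q) ->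
  'D_v (fun q => f (g1 q, g2 q)) q =
  'D_v g1 q * 'D_(dX R) f (g1 q, g2 q) + 'D_v g2 q * 'D_(dY R) f (g1 q, g2 q).
Proof.
move=> d1 d2 df.
have dp : differentiable (fun q => (g1 q, g2 q)) q by exact: differentiable_pair.
rewrite deriveE; last exact: (differentiable_comp dp df).
rewrite (diff_comp dp df) /= diff_pair // !deriveE //.
exact: linear_pairE.
Qed.

(** Used with [g] a first partial derivative of a Monge function: where it vanishes, the second
    derivatives of the inner functions drop out of the chain rule. *)
Lemma is_derive_mulr0 f g q w (dg : R^o) : derivable f q w -> g q = 0 ->
  is_derive q w g dg -> is_derive q w (f * g) (f q * dg).
Proof.
move=> df g0 Dg; apply: (is_derive_eq (is_deriveM (derivableP df) Dg)).
by rewrite g0 scale0r addr0.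
Qed.

(** The base point is named (c, d) through equations so that the formula can be used at the literal
    point (0, 0). *)
Lemma derive2_comp_pair (U V : set (R^o * R^o)) f (g1 g2 : R^o * R^o -> R^o) q v w (c d : R^o) :
  g1 q = c -> g2 q = d ->
  open U -> U q -> open V -> smooth_on V f ->
  (forall q, U q -> V (g1 q, g2 q)) ->
  (forall q, U q -> differentiable g1 q /\ differentiable g2 q) ->
  derivable ('D_v g1) q w -> derivable ('D_v g2) q w ->
  'D_(dX R) f (c, d) = 0 -> 'D_(dY R) f (c, d) = 0 ->
  'D_w ('D_v (fun q => f (g1 q, g2 q))) q =
  'D_v g1 q * ('D_w g1 q * 'D_(dX R) ('D_(dX R) f) (c, d) +
               'D_w g2 q * 'D_(dY R) ('D_(dX R) f) (c, d)) +
  'D_v g2 q * ('D_w g1 q * 'D_(dX R) ('D_(dY R) f) (c, d) +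
               'D_w g2 q * 'D_(dY R) ('D_(dY R) f) (c, d)).
Proof.
move=> <- <- oU Uq oV sf gUV dg d1 d2 fX fY.
have [dg1 dg2] := dg _ Uq.
have dfX : differentiable ('D_(dX R) f) (g1 q, g2 q).
  exact: sf [:: dX R] _ (gUV _ Uq).
have dfY : differentiable ('D_(dY R) f) (g1 q, g2 q).
  exact: sf [:: dY R] _ (gUV _ Uq).
have dp : differentiable (fun q => (g1 q, g2 q)) q by exact: differentiable_pair.
have /derivableP DX : derivable (fun q => 'D_(dX R) f (g1 q, g2 q)) q w.
  by apply: diff_derivable; exact: (differentiable_comp dp dfX).
have /derivableP DY : derivable (fun q => 'D_(dY R) f (g1 q, g2 q)) q w.
  by apply: diff_derivable; exact: (differentiable_comp dp dfY).
transitivity ('D_w ('D_v g1 * (fun q => 'D_(dX R) f (g1 q, g2 q)) +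
    'D_v g2 * (fun q => 'D_(dY R) f (g1 q, g2 q))) q); last first.
  have [_ ->] := is_deriveD (is_derive_mulr0 d1 fX DX) (is_derive_mulr0 d2 fY DY).
  congr (_ * _ + _ * _); exact: derive_comp_pair.
apply: near_eq_derive.
apply: (near_open oU Uq) => q' Uq'; have [d1' d2'] := dg _ Uq'.
by rewrite derive_comp_pair //; exact: sf [::] _ (gUV _ Uq').
Qed.

End chain_rule.

(** * Determinants and pencils of binary quadratic forms *)

Section det4.
Variable R : realType.
Implicit Types (a b c d v w : 'cV[R]_4).

Lemma det_mxfun4 (f : nat -> nat -> R) :
  \det (\matrix_(i < 4, j < 4) f i j) =
  f 0%N 0%N * (f 1%N 1%N * (f 2%N 2%N * f 3%N 3%N - f 2%N 3%N * f 3%N 2%N)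
             - f 1%N 2%N * (f 2%N 1%N * f 3%N 3%N - f 2%N 3%N * f 3%N 1%N)
             + f 1%N 3%N * (f 2%N 1%N * f 3%N 2%N - f 2%N 2%N * f 3%N 1%N))
- f 0%N 1%N * (f 1%N 0%N * (f 2%N 2%N * f 3%N 3%N - f 2%N 3%N * f 3%N 2%N)
             - f 1%N 2%N * (f 2%N 0%N * f 3%N 3%N - f 2%N 3%N * f 3%N 0%N)
             + f 1%N 3%N * (f 2%N 0%N * f 3%N 2%N - f 2%N 2%N * f 3%N 0%N))
+ f 0%N 2%N * (f 1%N 0%N * (f 2%N 1%N * f 3%N 3%N - f 2%N 3%N * f 3%N 1%N)
             - f 1%N 1%N * (f 2%N 0%N * f 3%N 3%N - f 2%N 3%N * f 3%N 0%N)
             + f 1%N 3%N * (f 2%N 0%N * f 3%N 1%N - f 2%N 1%N * f 3%N 0%N))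
- f 0%N 3%N * (f 1%N 0%N * (f 2%N 1%N * f 3%N 2%N - f 2%N 2%N * f 3%N 1%N)
             - f 1%N 1%N * (f 2%N 0%N * f 3%N 2%N - f 2%N 2%N * f 3%N 0%N)
             + f 1%N 2%N * (f 2%N 0%N * f 3%N 1%N - f 2%N 1%N * f 3%N 0%N)).
Proof.
do 3 (rewrite ?(expand_det_row _ ord0) ?big_ord_recl ?big_ord0 /cofactor /=).
rewrite !det_mx11 !mxE /= /bump /=.
rewrite ?addn0 ?add0n ?expr0 ?expr1 ?exprS /=.
ring.
Qed.

(** Indexing by natural numbers keeps the indices literal, so that [ring] can compare entries in
    expanded determinants. *)
Definition entry4 v (i : nat) : R := v (inord i) 0.

Lemma row_mx4E a b c d :
  (row_mx a (row_mx b (row_mx c d)) : 'M[R]_4) =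
  \matrix_(i < 4, j < 4) nth (fun=> 0) [:: entry4 a; entry4 b; entry4 c; entry4 d] j i.
Proof.
apply/matrixP => i j; rewrite [RHS]mxE.
have E v : v i 0 = entry4 v i by rewrite /entry4 inord_val.
rewrite mxE; case: splitP => k jk /=; rewrite ?ord1 ?E; first by rewrite jk ord1.
rewrite mxE; case: splitP => l kl /=; rewrite ?ord1 ?E; first by rewrite jk kl ord1.
rewrite mxE; case: splitP => r lr /=; rewrite ?ord1 ?E; by rewrite jk kl lr ord1.
Qed.


Lemma det4E a b c d : let E v i := entry4 v i in
  det4 a b c d =
  E a 0 * (E b 1 * (E c 2 * E d 3 - E d 2 * E c 3)
             - E c 1 * (E b 2 * E d 3 - E d 2 * E b 3)
             + E d 1 * (E b 2 * E c 3 - E c 2 * E b 3))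
- E b 0 * (E a 1 * (E c 2 * E d 3 - E d 2 * E c 3)
             - E c 1 * (E a 2 * E d 3 - E d 2 * E a 3)
             + E d 1 * (E a 2 * E c 3 - E c 2 * E a 3))
+ E c 0 * (E a 1 * (E b 2 * E d 3 - E d 2 * E b 3)
             - E b 1 * (E a 2 * E d 3 - E d 2 * E a 3)
             + E d 1 * (E a 2 * E b 3 - E b 2 * E a 3))
- E d 0 * (E a 1 * (E b 2 * E c 3 - E c 2 * E b 3)
             - E b 1 * (E a 2 * E c 3 - E c 2 * E a 3)
             + E c 1 * (E a 2 * E b 3 - E b 2 * E a 3)).
Proof.
rewrite /det4 row_mx4E.
exact: (det_mxfun4
  (fun i j => nth (fun=> 0) [:: entry4 a; entry4 b; entry4 c; entry4 d] j i)).
Qed.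

Lemma det4_mulmx (M : 'M[R]_4) a b c d :
  det4 (M *m a) (M *m b) (M *m c) (M *m d) = \det M * det4 a b c d.
Proof. by rewrite /det4 -!mul_mx_row det_mulmx. Qed.

Lemma entry4D v w i : entry4 (v + w) i = entry4 v i + entry4 w i.
Proof. by rewrite /entry4 mxE. Qed.

Lemma entry4Z (t : R) v i : entry4 (t *: v) i = t * entry4 v i.
Proof. by rewrite /entry4 mxE. Qed.

(** With a = x' and c = e', this exchanges x' for the tangent vector F_u = x' + t e'. *)
Lemma det4_shear a b c d (t : R) : det4 (a + t *: c) b c d = det4 a b c d.
Proof. by rewrite !det4E /= !entry4D !entry4Z; ring. Qed.

Lemma det4_linearr a b c d d' (t : R) :
  det4 a b c (d + t *: d') = det4 a b c d + t * det4 a b c d'.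
Proof. by rewrite !det4E /= !entry4D !entry4Z; ring. Qed.

Lemma det4_block a b c d :
  entry4 a 2 = 0 -> entry4 a 3 = 0 -> entry4 b 2 = 0 -> entry4 b 3 = 0 ->
  det4 a b c d = (entry4 a 0 * entry4 b 1 - entry4 b 0 * entry4 a 1) *
     (entry4 c 2 * entry4 d 3 - entry4 d 2 * entry4 c 3).
Proof. by move=> a2 a3 b2 b3; rewrite det4E /= a2 a3 b2 b3; ring. Qed.

Lemma free_det4 a b c d : free [:: a; b; c; d] -> det4 a b c d != 0.
Proof.
move=> fr; apply/negP => /eqP D0.
have /eqP : \det (row_mx a (row_mx b (row_mx c d)) : 'M[R]_4)^T = 0 by rewrite det_tr.
case/det0P => v v0 vM.
have := @freeP _ _ 4 [tuple a; b; c; d]; rewrite fr => /elimT /(_ isT (fun i => v 0 i)) H.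
case/negP: v0; apply/eqP/rowP => i; rewrite [RHS]mxE; apply: H.
move: vM; rewrite row_mx4E => vM.
apply/colP => k; have /matrixP /(_ 0 k) := vM.
rewrite summxE [in X in X -> _]mxE !mxE => E; rewrite -[RHS]E.
apply: eq_bigr => j _; rewrite !mxE; congr (_ * _).
by case: j => [[|[|[|[|//]]]] ?] /=; rewrite /entry4 inord_val.
Qed.

Lemma free_det4_extend a b c : free [:: a; b; c] -> exists d, det4 a b c d != 0.
Proof.
move=> fr.
have [d dn] : exists d, d \notin <<[:: a; b; c]>>%VS.
  apply: contrapT => /forallNP H.
  have : (fullv <= <<[:: a; b; c]>>)%VS.
    by apply/subvP => w _; apply: contrapT => /negP /H.
  move/dimvS; rewrite dimvf (eqP fr) /dim /=.
  by [].
exists d; apply: free_det4.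
have P : perm_eq (rcons [:: a; b; c] d) (d :: [:: a; b; c]) by rewrite perm_rcons.
by rewrite -[X in free X]/(rcons [:: a; b; c] d) (perm_free P) free_cons dn fr.
Qed.

End det4.

(** * Rank and invariants of a pair of binary quadratic forms *)

Section pencil.
Variable R : realType.

Lemma rank_mx22 (G : 'M[R]_2) : G != 0 ->
  \rank G = if \det G == 0 then 1%N else 2%N.
Proof.
move=> G0; case: ifPn => D.
  apply/eqP; rewrite eqn_leq lt0n mxrank_eq0 G0 andbT -ltnS ltn_neqAle rank_leq_row andbT.
  apply: contraL D => /eqP r2; rewrite -unitfE -unitmxE -row_free_unit /row_free r2; exact: eqxx.
apply/eqP; change (row_free G); by rewrite row_free_unit unitmxE unitfE.
Qed.

(* The quadratic forms are (A1 X^2 + 2 C1 X Y) o J^-1 and (A2 X^2 + 2 C2 X Y) o J^-1,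
   up to the factor 1/2, where J = [[p, q], [r, s]]. *)
Lemma pencil_type (p q r s A1 C1 A2 C2 l m n a b c : R) :
  let d := p * s - q * r in
  d != 0 -> (C1 != 0) || (C2 != 0) ->
  d ^+ 2 * (2 * l) = A1 * s ^+ 2 - 2 * C1 * r * s ->
  d ^+ 2 * (2 * m) = - A1 * q * s + C1 * (p * s + q * r) ->
  d ^+ 2 * (2 * n) = A1 * q ^+ 2 - 2 * C1 * p * q ->
  d ^+ 2 * (2 * a) = A2 * s ^+ 2 - 2 * C2 * r * s ->
  d ^+ 2 * (2 * b) = - A2 * q * s + C2 * (p * s + q * r) ->
  d ^+ 2 * (2 * c) = A2 * q ^+ 2 - 2 * C2 * p * q ->
  [/\ delta l m n a b c = 0, curvK l m n a b c < 0 &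
    \rank (matA l m n a b c) = if C1 * A2 - A1 * C2 == 0 then 1%N else 2%N].
Proof.
move=> d d0 C0 El Em En Ea Eb Ec.
(* Scaling by k clears all denominators; [delta] is homogeneous of degree 4 and [curvK] of degree 2
   in the coefficients. *)
pose k := d ^+ 2 * 2.
have k0 : k != 0 by rewrite mulf_neq0 ?expf_neq0 // pnatr_eq0.
rewrite !mulrA -/k in El Em En Ea Eb Ec.
split.
(* [delta] is the resultant of the two forms, which share the linear factor X. *)
- apply: (mulfI (expf_neq0 4 k0)); rewrite mulr0.
  have -> : k ^+ 4 * delta l m n a b c =
     delta (k * l) (k * m) (k * n) (k * a) (k * b) (k * c) by rewrite /delta; ring.
  by rewrite El Em En Ea Eb Ec /delta; ring.
- have k2 : 0 < k ^+ 2 by rewrite lt_def sqr_ge0 sqrf_eq0 k0.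
  rewrite -(pmulr_rlt0 _ k2).
  have -> : k ^+ 2 * curvK l m n a b c =
     curvK (k * l) (k * m) (k * n) (k * a) (k * b) (k * c) by rewrite /curvK; ring.
  (* The discriminant of A X^2 + 2 C X Y is - C^2, and a change of variables multiplies it by the
     square of its determinant. *)
  have -> : curvK (k * l) (k * m) (k * n) (k * a) (k * b) (k * c) =
     - (d ^+ 2 * (C1 ^+ 2 + C2 ^+ 2)).
    by rewrite El Em En Ea Eb Ec /curvK /d; ring.
  rewrite oppr_lt0 mulr_gt0 //; first by rewrite lt_def sqr_ge0 sqrf_eq0 d0.
  by rewrite lt_def addr_ge0 ?sqr_ge0 // paddr_eq0 ?sqr_ge0 // !sqrf_eq0 negb_and C0.
pose G : 'M[R]_2 := \matrix_(i < 2, j < 2) (nth [::] [:: [:: A2; C2]; [:: A1; C1]] i)`_j.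
pose N : 'M[R]_(2, 3) := \matrix_(i < 2, j < 3)
  (nth [::] [:: [:: s ^+ 2; - (q * s); q ^+ 2];
                [:: - 2 * (r * s); p * s + q * r; - 2 * (p * q)]] i)`_j.
(* Up to a scalar, N is the action of J^-1 on the forms X^2 and 2 X Y, and Z is
   a right inverse of it, given by the action of J. *)
pose Z : 'M[R]_(3, 2) := \matrix_(i < 3, j < 2)
  (nth [::] [:: [:: p ^+ 2; p * q]; [:: 2 * (p * r); p * s + q * r]; [:: r ^+ 2; r * s]] i)`_j.
have NZ : N *m Z = (d ^+ 2)%:M.
  apply/matrixP => i j; rewrite !mxE !big_ord_recl big_ord0 !mxE /d.
  by case: i => [[|[|//]] ?]; case: j => [[|[|//]] ?]; rewrite /= ?mulr1n ?mulr0n; ring.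
(* As [N] has full row rank, the rank of the coefficient matrix is that of the 2 x 2 matrix [G],
   whose determinant is C1 A2 - A1 C2. *)
have GN : k *: matA l m n a b c = G *m N.
  apply/matrixP => i j; rewrite !mxE !big_ord_recl big_ord0 !mxE.
  case: i => [[|[|//]] ?]; case: j => [[|[|[|//]]] ?];
    rewrite /= ?Ea ?Eb ?Ec ?El ?Em ?En; ring.
have fN : row_free N.
  apply/row_freeP; exists ((d ^+ 2)^-1 *: Z).
  by rewrite -scalemxAr NZ scale_scalar_mx mulVf // expf_neq0.
rewrite -(mxrank_scale_nz _ k0) GN mxrankMfree // rank_mx22.
  rewrite (expand_det_row _ ord0) !big_ord_recl big_ord0 /cofactor !det_mx11 !mxE /=.
  rewrite /bump /= expr0 expr1 mul1r addr0.
  have -> : A2 * C1 + C2 * (-1 * A1) = C1 * A2 - A1 * C2 by ring.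
  by [].
apply: contraTneq C0 => /matrixP G0.
have := G0 0 1; have := G0 1 1; rewrite !mxE /= => -> ->.
by rewrite eqxx.
Qed.

End pencil.

(** * Monge forms of a ruled surface *)

Section monge_hessian.
Variable R : realType.

Definition ruled_scalar (a b : R -> R) (q : R^o * R^o) : R^o := a q.1 + q.2 * b q.1.

Lemma derive1n_subc (h : R -> R) (c : R) n :
  derive1n n.+1 (fun s => h s - c) = derive1n n.+1 h.
Proof.
rewrite !derive1Sn; congr (derive1n n _); apply/funext => s.
rewrite /derive1.
have -> // : (fun k : R => k^-1 *: (h (k + s) - c - (h s - c))) =
             (fun k => k^-1 *: (h (k + s) - h s)).
by apply/funext => k; congr (_ *: _); ring.
Qed.

Lemma smooth1_subc I (h : R -> R) (c : R) :
  smooth1 I h -> smooth1 I (fun s => h s - c).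
Proof.
move=> sh [|n] u Iu; last by rewrite derive1n_subc; exact: sh.
by exact: (derivableB (sh 0%N u Iu) (derivable_cst _ _ _)).
Qed.

(* In matrix form the hypothesis reads [[A, C], [C, 0]] = J^T h J, where
   J = [[p, q], [r, s]].  The symmetry of h is not assumed (so Schwarz's theorem
   is not needed): it follows from that of the left-hand side. *)
Lemma solve_congruence (p q r s h11 h12 h21 h22 A C : R) :
  (forall v w : R * R,
    v.1 * w.1 * A + (v.1 * w.2 + v.2 * w.1) * C =
    (v.1 * p + v.2 * q) * ((w.1 * p + w.2 * q) * h11 + (w.1 * r + w.2 * s) * h21)
    + (v.1 * r + v.2 * s) * ((w.1 * p + w.2 * q) * h12 + (w.1 * r + w.2 * s) * h22)) ->
  let d := p * s - q * r in
  d != 0 ->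
  [/\ d ^+ 2 * h11 = A * s ^+ 2 - 2 * C * r * s,
      d ^+ 2 * h12 = - A * q * s + C * (p * s + q * r) &
      d ^+ 2 * h22 = A * q ^+ 2 - 2 * C * p * q].
Proof.
move=> H d d0.
have := H (1, 0) (1, 0); have := H (1, 0) (0, 1).
have := H (0, 1) (1, 0); have := H (0, 1) (0, 1) => {H} /=.
rewrite !(mul0r, mul1r, add0r, addr0) => YY YX XY XX.
(* The difference of the two mixed equations is d (h21 - h12) = 0. *)
have h : h21 = h12.
  apply: (mulfI d0); apply/eqP; rewrite -subr_eq0 -(subrr C) {1}XY YX /d.
  by apply/eqP; ring.
subst h21; split; rewrite /d.
(* Inverting the congruence with the adjugate of J gives the lower right entry 0 the coefficient r^2
   here; writing that zero out gives [YY] a place to be substituted. The other two entries are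
   treated alike. *)
- transitivity (A * s ^+ 2 - 2 * C * r * s + r ^+ 2 * 0); last by ring.
  by rewrite YY XX XY; ring.
- transitivity (- A * q * s + C * (p * s + q * r) - p * r * 0); last by ring.
  by rewrite YY XX XY; ring.
- transitivity (A * q ^+ 2 - 2 * C * p * q + p ^+ 2 * 0); last by ring.
  by rewrite YY XX XY; ring.
Qed.

(** * One graph coordinate a + t b as a function [f] of the two base coordinates *)

Section ruled_graph.
Variables (I : set R) (a b a1 b1 a2 b2 : R -> R) (U V : set (R^o * R^o)).
Variables (f : R^o * R^o -> R^o) (u t : R).
Hypotheses (I_open : open I) (U_open : open U) (V_open : open V).
Hypotheses (sa : smooth1 I a) (sb : smooth1 I b) (sa1 : smooth1 I a1).
Hypotheses (sb1 : smooth1 I b1) (sa2 : smooth1 I a2) (sb2 : smooth1 I b2).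
Hypotheses (sf : smooth_on V f) (U0 : U (u, t)) (UI : forall q, U q -> I q.1).
Let g1 := ruled_scalar a1 b1.
Let g2 := ruled_scalar a2 b2.
Hypotheses (g10 : g1 (u, t) = 0) (g20 : g2 (u, t) = 0).
Hypotheses (fX : 'D_(dX R) f (0, 0) = 0) (fY : 'D_(dY R) f (0, 0) = 0).
Hypothesis gV : forall q, U q -> V (g1 q, g2 q).
Hypothesis gf : forall q, U q -> ruled_scalar a b q = f (g1 q, g2 q).

Let d_ruled (c d : R -> R) (sc : smooth1 I c) (sd : smooth1 I d) q :
  U q -> differentiable (ruled_scalar c d) q.
Proof.
by move=> /UI Iq; have [] := is_diff_ruled (sc 0%N _ Iq) (sd 0%N _ Iq).
Qed.

Let Iu : I u. Proof. exact: UI U0. Qed.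

Let D1 (c d : R -> R) (sc : smooth1 I c) (sd : smooth1 I d) v :
  'D_v (ruled_scalar c d) (u, t) = v.1 * (derive1 c u + t * derive1 d u) + v.2 * d u.
Proof. exact: (derive_ruled (q := (u, t)) v (sc 0%N u Iu) (sd 0%N u Iu)). Qed.

(** Chain rule with zero gradient: e and F_u have no component along this coordinate, which later
    makes the determinant block triangular. *)
Lemma ruled_graph_first_order : b u = 0 /\ derive1 a u + t * derive1 b u = 0.
Proof.
have H v : v.1 * (derive1 a u + t * derive1 b u) + v.2 * b u = 0.
  rewrite -(D1 sa sb).
  transitivity ('D_v (fun q => f (g1 q, g2 q)) (u, t)).
    exact: near_eq_derive (near_open U_open U0 gf).
  rewrite derive_comp_pair; last first.
  - exact: sf [::] _ (gV U0).
  - exact: d_ruled U0.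
  - exact: d_ruled U0.
  by rewrite g10 g20 fX fY !mulr0 addr0.
have := H (dX R); have := H (dY R); rewrite /= !mul0r !mul1r add0r addr0.
by [].
Qed.

Let p := derive1 a1 u + t * derive1 b1 u.
Let r := derive1 a2 u + t * derive1 b2 u.
Let q := b1 u.
Let s := b2 u.

Let D2 v w :
  v.1 * w.1 * (derive1n 2 a u + t * derive1n 2 b u) +
  (v.1 * w.2 + v.2 * w.1) * derive1 b u =
  (v.1 * p + v.2 * q) * ((w.1 * p + w.2 * q) * 'D_(dX R) ('D_(dX R) f) (0, 0) +
     (w.1 * r + w.2 * s) * 'D_(dY R) ('D_(dX R) f) (0, 0)) +
  (v.1 * r + v.2 * s) * ((w.1 * p + w.2 * q) * 'D_(dX R) ('D_(dY R) f) (0, 0) +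
     (w.1 * r + w.2 * s) * 'D_(dY R) ('D_(dY R) f) (0, 0)).
Proof.
have [_ E] := @derive2_ruled _ I _ _ (u, t) v w I_open sa sb Iu.
transitivity ('D_w ('D_v (ruled_scalar a b)) (u, t)); first exact: esym E.
transitivity ('D_w ('D_v (fun z => f (g1 z, g2 z))) (u, t)).
  apply: near_eq_derive; apply: (near_open U_open U0) => z Uz.
  exact: near_eq_derive (near_open U_open Uz gf).
have [d1 _] := @derive2_ruled _ I _ _ (u, t) v w I_open sa1 sb1 Iu.
have [d2 _] := @derive2_ruled _ I _ _ (u, t) v w I_open sa2 sb2 Iu.
have dg z : U z -> differentiable g1 z /\ differentiable g2 z.
  by move=> Uz; split; exact: d_ruled Uz.
apply: etrans (derive2_comp_pair g10 g20 U_open U0 V_open sf gV dg d1 d2 fX fY) _.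
by rewrite /g1 /g2 !D1.
Qed.

(** The primed letters and the equations let the Jacobian and Hessian entries be given directly as
    coordinates of transformed vectors, in the shape that [pencil_type] expects; the factors 2 undo
    the halves in [j2_quad]. *)
Lemma ruled_graph_second_order (l m n p' q' r' s' A C : R) :
  p = p' -> q = q' -> r = r' -> s = s' ->
  derive1n 2 a u + t * derive1n 2 b u = A -> derive1 b u = C ->
  j2_quad f l m n ->
  let d := p' * s' - q' * r' in
  d != 0 ->
  [/\ d ^+ 2 * (2 * l) = A * s' ^+ 2 - 2 * C * r' * s',
      d ^+ 2 * (2 * m) = - A * q' * s' + C * (p' * s' + q' * r') &
      d ^+ 2 * (2 * n) = A * q' ^+ 2 - 2 * C * p' * q'].
Proof.
move=> <- <- <- <- <- <- [El Em En] d d0.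
have H (k h : R) : k = h / 2 -> 2 * k = h by move=> ->; rewrite mulrC divfK // pnatr_eq0.
have [H1 H2 H3] := solve_congruence D2 d0.
by rewrite (H _ _ El) (H _ _ Em) (H _ _ En).
Qed.

End ruled_graph.
End monge_hessian.

(** * The type of a point read off from an arbitrary Monge form *)

Section monge_type.
Variable R : realType.

Lemma graph_pt_entry4 (f1 f2 : R^o * R^o -> R^o) (z : R^o * R^o) :
  [/\ entry4 (graph_pt f1 f2 z) 0 = z.1, entry4 (graph_pt f1 f2 z) 1 = z.2,
      entry4 (graph_pt f1 f2 z) 2 = f1 z & entry4 (graph_pt f1 f2 z) 3 = f2 z].
Proof. by split; rewrite /entry4 mxE inordK. Qed.

Lemma entry4_mulmxDZ (M : 'M[R]_4) (v w : 'cV[R]_4) (t : R) k :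
  entry4 (M *m (v + t *: w)) k = entry4 (M *m v) k + t * entry4 (M *m w) k.
Proof. by rewrite mulmxDr -scalemxAr entry4D entry4Z. Qed.

Section ruled_coordinates.
Variables (I : set R) (x e : R -> 'cV[R]_4) (M : 'M[R]_4) (P : 'cV[R]_4).
Hypotheses (I_open : open I)
  (x_smooth : smooth_on (I : set R^o) (x : R^o -> 'cV[R]_4))
  (e_smooth : smooth_on (I : set R^o) (e : R^o -> 'cV[R]_4)).

Definition coordx (k : nat) (s : R) : R := entry4 (M *m x s) k - entry4 (M *m P) k.
Definition coorde (k : nat) (s : R) : R := entry4 (M *m e s) k.

Lemma smooth1_coordx k : smooth1 I (coordx k).
Proof. by apply: smooth1_subc; exact: smooth1_mulmx_entry. Qed.

Lemma smooth1_coorde k : smooth1 I (coorde k).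
Proof. exact: smooth1_mulmx_entry. Qed.

Lemma derive1n_coordx k n s : I s ->
  derive1n n.+1 (coordx k) s = entry4 (M *m derive1n n.+1 x s) k.
Proof. by move=> Is; rewrite derive1n_subc (derive1n_mulmx_entry M _ I_open x_smooth). Qed.

Lemma derive1n_coorde k n s : I s ->
  derive1n n (coorde k) s = entry4 (M *m derive1n n e s) k.
Proof. by move=> Is; rewrite (derive1n_mulmx_entry M _ I_open e_smooth). Qed.

Lemma ruled_scalar_coord k (q : R^o * R^o) :
  ruled_scalar (coordx k) (coorde k) q = entry4 (M *m (ruled x e q - P)) k.
Proof.
rewrite /ruled_scalar /coordx /coorde /ruled mulmxBr mulmxDr -scalemxAr.
by rewrite /entry4 !mxE; ring.
Qed.

End ruled_coordinates.

Lemma monge_form_type (I : set R) (x e : R -> 'cV[R]_4) (u t : R)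
    (B : 'M[R]_4) (f1 f2 : R^o * R^o -> R^o) (l m n a b c : R) :
  open I ->
  smooth_on (I : set R^o) (x : R^o -> 'cV[R]_4) ->
  smooth_on (I : set R^o) (e : R^o -> 'cV[R]_4) ->
  I u -> free [:: derive1 x u; e u; derive1 e u] ->
  monge_form [set q : R^o * R^o | I q.1] (ruled x e) (u, t) B f1 f2 ->
  j2_quad f1 l m n -> j2_quad f2 a b c ->
  [/\ delta l m n a b c = 0, curvK l m n a b c < 0 &
      \rank (matA l m n a b c) =
      if det4 (derive1 x u) (e u) (derive1 e u)
              (derive1n 2 x u + t *: derive1n 2 e u) == 0 then 1%N else 2%N].
Proof.
move=> oI sx se Iu fr [Bu [U [V [[oU U0 UD] [[oV V0 s1 s2] [FUV [_ X1 Y1] [_ X2 Y2]]]]]]].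
move=> j1 j2.
set P := ruled x e (u, t) in FUV.
pose M := invmx B.
(* The equality of images only yields some z for each q; comparing the first two coordinates then
   forces z = (g 0 q, g 1 q). *)
have gU q : U q -> exists2 z, V z & M *m (ruled x e q - P) = graph_pt f1 f2 z.
  move=> Uq; have : (ruled x e @` U) (ruled x e q) by exists q.
  rewrite FUV => -[z Vz <-]; exists z => //.
  by rewrite addrC addKr mulKmx.
pose g k := ruled_scalar (coordx x M P k) (coorde e M k).
have gE q : U q -> [/\ V (g 0%N q, g 1%N q), g 2%N q = f1 (g 0%N q, g 1%N q) &
    g 3%N q = f2 (g 0%N q, g 1%N q)].
  move=> Uq; have [z Vz E] := gU _ Uq; rewrite /g !ruled_scalar_coord E.
  by have [-> -> -> ->] := graph_pt_entry4 f1 f2 z; rewrite -surjective_pairing.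
have g0 k : g k (u, t) = 0.
  by rewrite /g ruled_scalar_coord subrr mulmx0 /entry4 mxE.
have gV q : U q -> V (g 0%N q, g 1%N q) by case/gE.
have gf1 q : U q -> g 2%N q = f1 (g 0%N q, g 1%N q) by case/gE.
have gf2 q : U q -> g 3%N q = f2 (g 0%N q, g 1%N q) by case/gE.
have sX k : smooth1 I (coordx x M P k) by exact: smooth1_coordx.
have sE k : smooth1 I (coorde e M k) by exact: smooth1_coorde.
have [b2 a2] := ruled_graph_first_order oU (sX 2%N) (sE 2%N) (sX 0%N) (sE 0%N)
  (sX 1%N) (sE 1%N) s1 U0 UD (g0 0%N) (g0 1%N) X1 Y1 gV gf1.
have [b3 a3] := ruled_graph_first_order oU (sX 3%N) (sE 3%N) (sX 0%N) (sE 0%N)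
  (sX 1%N) (sE 1%N) s2 U0 UD (g0 0%N) (g0 1%N) X2 Y2 gV gf2.
pose Fu := derive1 x u + t *: derive1 e u.
pose Fuu := derive1n 2 x u + t *: derive1n 2 e u.
have dFu k : derive1 (coordx x M P k) u + t * derive1 (coorde e M k) u =
    entry4 (M *m Fu) k.
  rewrite entry4_mulmxDZ; congr (_ + t * _).
    exact: (derive1n_coordx M P oI sx k 0 Iu).
  exact: (derive1n_coorde M oI se k 1 Iu).
have dFuu k : derive1n 2 (coordx x M P k) u + t * derive1n 2 (coorde e M k) u =
    entry4 (M *m Fuu) k.
  rewrite entry4_mulmxDZ; congr (_ + t * _).
    exact: (derive1n_coordx M P oI sx k 1 Iu).
  exact: (derive1n_coorde M oI se k 2 Iu).
have de k : derive1 (coorde e M k) u = entry4 (M *m derive1 e u) k.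
  exact: (derive1n_coorde M oI se k 1 Iu).
have {}a2 := etrans (esym (dFu 2%N)) a2.
have {}a3 := etrans (esym (dFu 3%N)) a3.
have H1 := ruled_graph_second_order oI oU oV (sX 2%N) (sE 2%N) (sX 0%N) (sE 0%N)
  (sX 1%N) (sE 1%N) s1 U0 UD (g0 0%N) (g0 1%N) X1 Y1 gV gf1
  (dFu 0%N) erefl (dFu 1%N) erefl (dFuu 2%N) (de 2%N) j1.
have H2 := ruled_graph_second_order oI oU oV (sX 3%N) (sE 3%N) (sX 0%N) (sE 0%N)
  (sX 1%N) (sE 1%N) s2 U0 UD (g0 0%N) (g0 1%N) X2 Y2 gV gf2
  (dFu 0%N) erefl (dFu 1%N) erefl (dFuu 3%N) (de 3%N) j2.
have dM : \det M != 0 by rewrite -unitfE -unitmxE unitmx_inv.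
(* In the new coordinates F_u and e have zero third and fourth entries, so the determinant splits
   into the Jacobian of the base coordinates and a normal 2 x 2 minor. The choice of [v] gives
   nondegeneracy below, and with [Fuu] the rank criterion. *)
have D4 v : \det M * det4 (derive1 x u) (e u) (derive1 e u) v =
   (entry4 (M *m Fu) 0 * entry4 (M *m e u) 1 - entry4 (M *m e u) 0 * entry4 (M *m Fu) 1) *
   (entry4 (M *m derive1 e u) 2 * entry4 (M *m v) 3 -
    entry4 (M *m v) 2 * entry4 (M *m derive1 e u) 3).
  by rewrite -(det4_shear _ _ _ _ t) -det4_mulmx det4_block.
(* Completing Fu, e, e' to a basis yields at once the invertibility of the
   Jacobian and the fact that e' is not in the tangent plane. *)
have [w w0] := free_det4_extend fr.
have := mulf_neq0 dM w0; rewrite D4 mulf_eq0 negb_or => /andP[d0 Cw].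
have [l1 m1 n1] := H1 d0; have [l2 m2 n2] := H2 d0.
have := pencil_type d0 _ l1 m1 n1 l2 m2 n2.
case.
  apply: contraNT Cw; rewrite negb_or !negbK => /andP[/eqP -> /eqP ->].
  by rewrite mul0r mulr0 subrr.
move=> -> -> ->; split => //.
have := D4 Fuu; rewrite -/Fuu => D.
have -> : (det4 (derive1 x u) (e u) (derive1 e u) Fuu == 0) =
   (\det M * det4 (derive1 x u) (e u) (derive1 e u) Fuu == 0).
  by rewrite mulf_eq0 (negbTE dM).
by rewrite D mulf_eq0 (negbTE d0).
Qed.

End monge_type.

(** * Implicit functions *)

Section implicit.
Variable R : realType.

(** Expanding 0 = Phi(w z, z) at z0 leaves an error o(|(w z - w z0, z - z0)|); the Lipschitz bound
    turns it into o(|z - z0|), and one solves for w z - w z0. *)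
Lemma is_diff_implicit (V : normedModType R) (Phi : R^o * V -> R^o)
    (dPhi : R^o * V -> R^o) (w : V -> R^o) (z0 : V) (C : R) :
  is_diff (w z0, z0) Phi dPhi -> dPhi (1, 0) != 0 ->
  (\forall z \near z0, Phi (w z, z) = 0) ->
  (\forall z \near z0, `|w z - w z0| <= C * `|z - z0|) ->
  is_diff z0 w (fun h => - (dPhi (1, 0))^-1 * dPhi (0, h)).
Proof.
move=> DPhi; set D0 := dPhi (1, 0) => D0_neq0 Phi0 lip.
pose iota := fun z : V => (w z0, z) : R^o * V.
have diota : is_diff z0 iota (fun h => (0, h)) by exact: is_diff_pair.
have Dk : is_diff z0 (fun z => Phi (iota z)) (dPhi \o (fun h => (0, h))).
  exact: is_diff_comp.
have DL := is_diffZ (- D0^-1) Dk.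
have [dk Ek] := DL.
set L := 'd _ z0 in Ek.
have cL : continuous L by exact: diff_continuous dk.
have LE h : L h = - D0^-1 * dPhi (0, h) by rewrite Ek.
suff H : is_diff z0 w L by apply: (is_diff_eq H); apply/funext.
have [dPhi_diff EPhi] := DPhi.
have dPhiE a h : dPhi (a, h) = a * D0 + dPhi (0, h).
  rewrite /D0 -EPhi.
  have -> : (a, h) = a *: (1, 0) + (0, h) :> R^o * V.
    by congr pair; rewrite /= ?scaler0 ?add0r // addr0 /GRing.scale /= mulr1.
  by rewrite linearD linearZ.
(* The sign of [C] is unknown. The constant |C| + 1 is positive, and being at least 1 it bounds both
   components of the increment. *)
have C1 : 0 < `|C| + 1 by rewrite ltr_wpDl.
have lip1 : \forall z \near z0, `|w z - w z0| <= (`|C| + 1) * `|z - z0|.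
  apply: filterS lip => z /le_trans; apply; rewrite ler_wpM2r //.
  by rewrite (le_trans (ler_norm C)) // lerDl.
have cw0 : w @ z0 --> w z0.
  apply/cvgrPdist_le => e e0.
  have near_e : \forall z \near z0, `|z0 - z| <= e / (`|C| + 1).
    exact: (@cvgr_dist_le _ _ _ (nbhs z0) _ id z0 cvg_id _ (divr_gt0 e0 C1)).
  near=> z; rewrite distrC; apply: (le_trans (near lip1 z _)) => //.
  rewrite mulrC -ler_pdivlMr // distrC; exact: (near near_e z).
have cw : (fun z => (w z, z)) @ z0 --> (w z0, z0).
  exact: (@cvg_pair _ _ _ _ _ _ _ _ _ w id cw0 cvg_id).
apply/is_diffP => // e e0.
(* The tolerance anticipates the loss of a factor |C| + 1 from the increment and the final division
   by |D0|. *)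
have e1 : 0 < e * `|D0| / (`|C| + 1) by rewrite divr_gt0 // mulr_gt0 // normr_gt0.
have cdPhi : continuous ('d Phi (w z0, z0)) by exact: diff_continuous dPhi_diff.
have o_Phi := (@is_diffP _ _ _ Phi _ (w z0, z0) cdPhi).1 (differentiableP dPhi_diff) _ e1.
have near_Phi : \forall z \near z0,
    `|Phi (w z, z) - (Phi (w z0, z0) + 'd Phi (w z0, z0) ((w z, z) - (w z0, z0)))| <=
     e * `|D0| / (`|C| + 1) * `|(w z, z) - (w z0, z0) : R^o * V| by exact: cw o_Phi.
have P0 : Phi (w z0, z0) = 0 by exact: nbhs_singleton Phi0.
apply: filterS3 near_Phi Phi0 lip1 => z B Pz zlip.
have H : `|(w z - w z0) * D0 + dPhi (0, z - z0)| <=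
    e * `|D0| / (`|C| + 1) * Num.max `|w z - w z0| `|z - z0|.
  by rewrite -dPhiE; move: B; rewrite Pz P0 EPhi !add0r normrN.
have {}H : `|(w z - w z0) * D0 + dPhi (0, z - z0)| <= e * `|D0| * `|z - z0|.
  apply: le_trans H _.
  rewrite -[leLHS]mulrA; apply: ler_wpM2l; first by rewrite mulr_ge0 // ltW.
  by rewrite ler_pdivrMl // ge_max zlip ler_peMl // lerDr.
rewrite LE.
have -> : w z - (w z0 + - D0^-1 * dPhi (0, z - z0)) =
    D0^-1 * ((w z - w z0) * D0 + dPhi (0, z - z0)).
  by move: (dPhi _) => y; field; exact: D0_neq0.
by rewrite normrM normfV mulrC ler_pdivrMr ?normr_gt0 // mulrAC.
Unshelve. all: by end_near. Qed.

End implicit.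

(** * Smoothness of expressions in an implicit function *)

Section implicit_algebra.
Variables (R : realType) (I : set R) (V : set (R^o * R^o)).
Variable w : R^o * R^o -> R^o.
Hypotheses (V_open : open V) (wI : forall z, V z -> I (w z)).

(* If Dw below holds, this algebra is stable under directional derivatives, so
   [smooth_on_coind] applies to it. *)
Inductive implicit_algebra : (R^o * R^o -> R^o) -> Prop :=
| alg_cst c : implicit_algebra (cst c)
| alg_fst : implicit_algebra fst
| alg_snd : implicit_algebra snd
| alg_comp h : smooth1 I h -> implicit_algebra (fun z => h (w z))
| alg_add f g : implicit_algebra f -> implicit_algebra g -> implicit_algebra (f + g)
| alg_mul f g : implicit_algebra f -> implicit_algebra g -> implicit_algebra (f * g)
| alg_inv f : implicit_algebra f -> (forall z, V z -> f z != 0) ->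
    implicit_algebra (fun z => (f z)^-1).

Hypothesis dw : forall z, V z -> differentiable w z.
Hypothesis Dw : forall v, exists2 g, implicit_algebra g &
  forall z, V z -> 'D_v w z = g z.

Lemma implicit_algebra_smooth f : implicit_algebra f -> smooth_on V f.
Proof.
apply: smooth_on_coind => // {}f; elim.
- move=> c; split=> [z _|v]; first exact: differentiable_cst.
  by exists (cst 0); [exact: alg_cst|move=> z _; rewrite derive_cst].
- split=> [z _|v]; first by have [] := is_diff_fst z.
  exists (cst v.1); [exact: alg_cst|move=> z _].
  by have [d E] := is_diff_fst z; rewrite deriveE // E.
- split=> [z _|v]; first by have [] := is_diff_snd z.
  exists (cst v.2); [exact: alg_cst|move=> z _].
  by have [d E] := is_diff_snd z; rewrite deriveE // E.
- move=> h sh; have D z : V z ->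
      is_diff z (fun z => h (w z) : R^o) (fun y => derive1 h (w z) * 'd w z y).
    move=> Vz; apply: is_diff_comp1; first exact: sh 0%N _ (wI Vz).
    exact: differentiableP (dw Vz).
  split=> [z Vz|v]; first by have [] := D _ Vz.
  have [g Sg Dg] := Dw v.
  exists ((fun z => derive1 h (w z)) * g).
    by apply: alg_mul Sg; apply: alg_comp; exact: smooth1_derive1.
  move=> z Vz; have [d E] := D _ Vz.
  by rewrite deriveE // E -deriveE ?Dg //; exact: dw.
- move=> f1 f2 Sf1 [d1 D1] Sf2 [d2 D2]; split=> [z Vz|v].
    by apply: differentiableD; [exact: d1|exact: d2].
  have [g1 Sg1 E1] := D1 v; have [g2 Sg2 E2] := D2 v.
  exists (g1 + g2); first exact: alg_add.
  move=> z Vz; rewrite deriveD ?E1 ?E2 //; exact: diff_derivable (_ z Vz).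
- move=> f1 f2 Sf1 [d1 D1] Sf2 [d2 D2]; split=> [z Vz|v].
    by apply: differentiableM; [exact: d1|exact: d2].
  have [g1 Sg1 E1] := D1 v; have [g2 Sg2 E2] := D2 v.
  exists (f1 * g2 + f2 * g1); first by apply: alg_add; exact: alg_mul.
  move=> z Vz; rewrite deriveM ?E1 ?E2 //; exact: diff_derivable (_ z Vz).
- move=> f1 Sf1 [d1 D1] f1n0; split=> [z Vz|v].
    by apply: differentiableV; [exact: d1|exact: f1n0].
  have [g1 Sg1 E1] := D1 v.
  exists (cst (-1) * ((fun z => (f1 z)^-1) * (fun z => (f1 z)^-1) * g1)).
    apply: alg_mul; first exact: alg_cst.
    by apply: alg_mul Sg1; apply: alg_mul; exact: alg_inv.
  move=> z Vz; rewrite deriveV ?E1 //; [|exact: f1n0|exact: diff_derivable (d1 z Vz)].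
  by rewrite !fctE /= /GRing.scale /= expr2 invfM mulN1r mulNr.
Qed.

End implicit_algebra.

(** * Local inverse of (s, y) -> (a s + y b s, c s + y d s) at (u, t) *)

Section local_inverse.
Variables (R : realType) (I : set R) (a b c d : R -> R) (u t : R).
Hypotheses (I_open : open I) (Iu : I u).
Hypotheses (sa : smooth1 I a) (sb : smooth1 I b) (sc : smooth1 I c) (sd : smooth1 I d).
Hypotheses (bu : b u = 0) (du : d u = 1) (au : a u = 0) (cu : c u = - t).
Hypothesis jac : derive1 a u + t * derive1 b u = 1.

(* Eliminating y from the system (a s + y b s, c s + y d s) = z gives H s z = 0. *)
Let P s := a s * d s - c s * b s.
Let dP s := derive1 a s * d s + a s * derive1 d s - (derive1 c s * b s + c s * derive1 b s).
Let H s (z : R^o * R^o) := z.1 * d s - z.2 * b s - P s.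
Let dH s (z : R^o * R^o) := z.1 * derive1 d s - z.2 * derive1 b s - dP s.

Let Dh h s : smooth1 I h -> I s -> is_derive s 1 h (derive1 h s).
Proof. by move=> sh Is; rewrite derive1E; exact/derivableP/(sh 0%N). Qed.

Let Ch h s : smooth1 I h -> I s -> h @ s --> h s.
Proof.
move=> sh Is; apply: (differentiable_continuous (f := h : R^o -> R^o)).
by apply/derivable1_diffP; exact: sh 0%N _ Is.
Qed.

Let DP s : I s -> is_derive s 1 P (dP s).
Proof.
move=> Is; apply: (is_derive_eq (is_deriveB (is_deriveM (Dh sa Is) (Dh sd Is))
  (is_deriveM (Dh sc Is) (Dh sb Is)))).
by rewrite /GRing.scale /= /dP; ring.
Qed.

Let DH s z : I s -> is_derive s 1 (fun s => H s z) (dH s z).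
Proof.
move=> Is.
exact: (is_deriveB (is_deriveB (is_deriveZ z.1 (Dh sd Is)) (is_deriveZ z.2 (Dh sb Is)))
  (DP Is)).
Qed.

(** At u this derivative is the Jacobian determinant of the map, normalised to 1. *)
Let dPu : dP u = 1.
Proof. by rewrite -[RHS]jac /dP bu du au cu; ring. Qed.

Let near_region : exists2 rK : R * R, 0 < rK.1 &
  forall s, `|s - u| <= rK.1 -> [/\ I s, 1 / 2 < d s, 1 / 2 < dP s &
   [/\ `|b s| <= rK.2, `|d s| <= rK.2, `|derive1 b s| <= rK.2 & `|derive1 d s| <= rK.2]].
Proof.
have h12 : 1 / 2 < 1 :> R by lra.
(* The final 1 makes K strictly larger than each of the four absolute values at u, so the bounds
   persist nearby. *)
have [K KE] : exists K : R, K = `|b u| + `|d u| + `|derive1 b u| + `|derive1 d u| + 1.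
  by eexists.
have nearK h : smooth1 I h -> `|h u| < K -> \forall s \near u, `|h s| <= K.
  by move=> sh hK; exact: (cvgr_norm_le _ (Ch sh Iu) K hK).
have c1 h : smooth1 I h -> derive1 h @ u --> derive1 h u.
  by move=> sh; apply: Ch Iu; exact: smooth1_derive1.
have N1 : \forall s \near u, I s by exact: open_nbhs_nbhs.
have N2 : \forall s \near u, 1 / 2 < d s.
  by apply: (cvgr_gt _ (Ch sd Iu)); rewrite du.
have N3 : \forall s \near u, 1 / 2 < dP s.
  have C : dP @ u --> dP u.
    apply: cvgB; apply: cvgD; apply: cvgM; by [exact: c1|exact: Ch].
  by apply: (cvgr_gt _ C); rewrite dPu.
have := normr_ge0 (b u); have := normr_ge0 (d u).
have := normr_ge0 (derive1 b u); have := normr_ge0 (derive1 d u) => ? ? ? ?.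
have N4 : \forall s \near u, `|b s| <= K by apply: nearK => //; lra.
have N5 : \forall s \near u, `|d s| <= K by apply: nearK => //; lra.
have N6 : \forall s \near u, `|derive1 b s| <= K.
  by apply: nearK; [exact: smooth1_derive1|lra].
have N7 : \forall s \near u, `|derive1 d s| <= K.
  by apply: nearK; [exact: smooth1_derive1|lra].
have N := filterI (filterI (filterI N1 N2) (filterI N3 N4))
  (filterI N5 (filterI N6 N7)).
have [e /= e0 eP] := (nbhs_ballP _ _).1 (N _ _ _ _ _ _).
(* Halving the radius places the closed interval inside the open ball. *)
exists (e / 2, K) => /=; first by rewrite divr_gt0.
move=> s se; have : ball u e s.
  by rewrite /ball /= distrC (le_lt_trans se) // ltr_pdivrMr // mulr_natr mulr2n ltrDl.
by move=> /eP [[[? ?] [? ?]] [? [? ?]]]; split.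
Qed.


(** The 8 keeps each of the two z-terms of [dH] below 1/8 in absolute value; with dP > 1/2 this
    leaves dH < -1/4. *)
Let small K (z : R^o * R^o) := `|z.1| * (8 * K) < 1 /\ `|z.2| * (8 * K) < 1.

Let ruled_local_inverse_stmt :=
  exists (U V : set (R^o * R^o)) (phi : R^o * R^o -> R^o * R^o),
  [/\ open U, U (u, t) & forall q, U q -> I q.1] /\
  [/\ open V, V (0, 0) & forall h k, smooth1 I h -> smooth1 I k ->
       smooth_on V (fun z => ruled_scalar h k (phi z))] /\
  [/\ forall q, U q -> V (ruled_scalar a b q, ruled_scalar c d q) /\
         phi (ruled_scalar a b q, ruled_scalar c d q) = q &
      forall z, V z -> U (phi z) /\
         (ruled_scalar a b (phi z), ruled_scalar c d (phi z)) = z].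

Section region.
Variables r K : R.
Hypothesis r0 : 0 < r.
Hypothesis region : forall s, `|s - u| <= r -> [/\ I s, 1 / 2 < d s, 1 / 2 < dP s &
   [/\ `|b s| <= K, `|d s| <= K, `|derive1 b s| <= K & `|derive1 d s| <= K]].

Let region_itv s1 s2 s : `|s1 - u| <= r -> `|s2 - u| <= r -> s \in `[s1, s2] -> `|s - u| <= r.
Proof.
rewrite !ler_norml in_itv /= => /andP[? ?] /andP[? ?] /andP[? ?].
by apply/andP; split; lra.
Qed.

Let mul_small x y : `|x| * (8 * K) < 1 -> `|y| <= K -> `|x * y| < 1 / 8.
Proof.
move=> xK yK; rewrite normrM.
have : `|x| * `|y| <= `|x| * K by rewrite ler_wpM2l.
by move: (`|x| * `|y|) => p; lra.
Qed.

Let dH_neg s z : `|s - u| <= r -> small K z -> dH s z < - (1 / 4).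
Proof.
move=> sr [z1 z2]; have [_ _ dPs [_ _ bK dK]] := region sr.
have := mul_small z1 dK; have := mul_small z2 bK.
rewrite !ltr_norml /dH => /andP[l1 l2] /andP[l3 l4].
by move: l1 l2 l3 l4 dPs; move: (z.1 * _) (z.2 * _) (dP s) => A B D; lra.
Qed.

(** The mean value theorem, stated with a slope so that the order of s1 and s2 does not matter. It
    yields the endpoint signs, the uniqueness of the root and its Lipschitz bound. *)
Let slope z s1 s2 : small K z -> `|s1 - u| <= r -> `|s2 - u| <= r ->
  exists2 m, m < - (1 / 4) & H s2 z - H s1 z = m * (s2 - s1).
Proof.
move=> sz; wlog s12 : s1 s2 / s1 <= s2 => [hw|] s1r s2r.
  have [/hw|/ltW s21] := leP s1 s2; first exact.
  have [m m0 E] := hw _ _ s21 s2r s1r; exists m => //.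
  by rewrite -opprB E -mulrN opprB.
have DHs s : s \in `[s1, s2] -> is_derive s 1 (fun s => H s z) (dH s z).
  by move=> /(region_itv s1r s2r) /region [Is _ _ _]; exact: DH.
have cont : {within `[s1, s2], continuous (fun s => H s z)}.
  by apply: derivable_within_continuous => s /DHs [].
have DHo s : s \in `]s1, s2[ -> is_derive s 1 (fun s => H s z) (dH s z).
  by move=> so; apply: DHs; exact: subset_itv_oo_cc so.
have [m mI E] := MVT_segment s12 DHo cont.
exists (dH m z) => //; apply: dH_neg => //; exact: region_itv mI.
Qed.

(** The strict signs at both ends are open conditions on z, and they are what the intermediate value
    theorem needs to place a root strictly inside the interval. *)
Let V := [set z | [/\ small K z, 0 < H (u - r) z & H (u + r) z < 0]].

Let small0 : small K (0, 0).
Proof. by rewrite /small /= normr0 mul0r. Qed.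

Let ur1 : `|(u - r) - u| <= r. Proof. by rewrite addrAC subrr add0r normrN gtr0_norm. Qed.
Let ur2 : `|(u + r) - u| <= r. Proof. by rewrite addrAC subrr add0r gtr0_norm. Qed.
Let uru : `|u - u| <= r. Proof. by rewrite subrr normr0 ltW. Qed.

Let V0 : V (0, 0).
Proof.
have H0 : H u (0, 0) = 0 by rewrite /H /P /= au bu; ring.
split => //.
  have [m m0 E] := slope small0 ur1 uru.
  have -> : H (u - r) (0, 0) = m * - r 
    by move: E; rewrite H0 sub0r => E; rewrite -[LHS]opprK E; ring.
  have m0' : m < 0 by lra.
  by rewrite nmulr_rgt0 // oppr_lt0.
have [m m0 E] := slope small0 uru ur2.
have -> : H (u + r) (0, 0) = m * r by move: E; rewrite H0 subr0 => ->; ring.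
have m0' : m < 0 by lra.
by rewrite nmulr_rlt0.
Qed.

Let H_continuous s : continuous (H s).
Proof.
move=> z; apply: cvgB; last exact: cvg_cst.
by apply: cvgB; apply: cvgM; first [exact: cvg_fst|exact: cvg_snd|exact: cvg_cst].
Qed.

Let V_open : open V.
Proof.
have -> : V = ((fun z => `|z.1| * (8 * K)) @^-1` [set x | x < 1] `&`
    (fun z => `|z.2| * (8 * K)) @^-1` [set x | x < 1]) `&`
  (H (u - r) @^-1` [set x | 0 < x] `&` H (u + r) @^-1` [set x | x < 0]).
  by apply/seteqP; split=> z; [case=> -[? ?] ? ?; split; split|case=> -[? ?] [? ?]; split].
apply: openI; apply: openI; apply: open_comp;
  do ?[exact: open_lt|exact: open_gt|by move=> z _; exact: H_continuous].
- move=> z _; apply: cvgM; last exact: cvg_cst.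
  by apply: cvg_norm; exact: cvg_fst.
- move=> z _; apply: cvgM; last exact: cvg_cst.
  by apply: cvg_norm; exact: cvg_snd.
Qed.

Let root_uniq z s1 s2 : small K z -> `|s1 - u| <= r -> `|s2 - u| <= r ->
  H s1 z = 0 -> H s2 z = 0 -> s1 = s2.
Proof.
move=> sz s1r s2r H1 H2; have [m m0 E] := slope sz s1r s2r.
move: E; rewrite H1 H2 subrr => /esym/eqP; rewrite mulf_eq0 => /orP[/eqP m00|].
  by exfalso; move: m0; rewrite m00; lra.
by rewrite subr_eq0 => /eqP.
Qed.

Let root_ex : exists w : R^o * R^o -> R^o,
  forall z, V z -> [/\ `|w z - u| < r & H (w z) z = 0].
Proof.
have : forall z, exists s : R^o, V z -> [/\ `|s - u| < r & H s z = 0].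
  (* Outside [V] the root takes the default value 0. *)
  move=> z; have [[sz Hm Hp]|nV] := pselect (V z); last by exists 0 => /nV.
  have ur : u - r <= u + r by move: r0; lra.
  have cont : {within `[u - r, u + r], continuous (fun s => H s z)}.
    apply: derivable_within_continuous => s /(region_itv ur1 ur2) /region [Is _ _ _].
    by have [] := DH z Is.
  have between : Num.min (H (u - r) z) (H (u + r) z) <= 0
      <= Num.max (H (u - r) z) (H (u + r) z).
    by rewrite ge_min le_max (ltW Hm) (ltW Hp) orbT.
  have [s sI Hs] := IVT ur cont between.
  exists s => _; split => //.
  move: sI; rewrite in_itv /= => /andP[s1 s2]; rewrite ltr_norml.
  have n1 : s != u - r by apply: contraTneq Hm => <-; rewrite Hs ltxx.
  have n2 : s != u + r by apply: contraTneq Hp => <-; rewrite Hs ltxx.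
  have l1 : u - r < s by rewrite lt_def n1.
  have l2 : s < u + r by rewrite lt_def eq_sym n2.
  by apply/andP; split; lra.
by case/(@boolp.choice (R^o * R^o)%type R^o) => w wP; exists w.
Qed.

Section root.
Variable w : R^o * R^o -> R^o.
Hypothesis wP : forall z, V z -> [/\ `|w z - u| < r & H (w z) z = 0].

Let w_r z : V z -> `|w z - u| <= r. Proof. by move=> /wP [/ltW]. Qed.

Let wI z : V z -> I (w z). Proof. by move=> /w_r /region []. Qed.

(** Since w z is a root for z, H (w z) z0 is linear in z0 - z and at most 2 K |z - z0| in size;
    dividing by a slope of size at least 1/4 gives 8 K. *)
Let w_lip z0 z : V z0 -> V z -> `|w z - w z0| <= 8 * K * `|z - z0|.
Proof.
move=> Vz0 Vz; have [sz0 _ _] := Vz0.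
have [m m0 E] := slope sz0 (w_r Vz0) (w_r Vz).
have [_ H0] := wP Vz0; have [_ Hz] := wP Vz.
have [_ _ _ [bK dK _ _]] := region (w_r Vz).
have {}E : m * (w z - w z0) = (z0.1 - z.1) * d (w z) - (z0.2 - z.2) * b (w z).
  by rewrite -E H0 -Hz /H; ring.
have nE : `|z - z0| = Num.max `|z.1 - z0.1| `|z.2 - z0.2| by [].
have n1 : `|z0.1 - z.1| <= `|z - z0| by rewrite nE distrC le_max lexx.
have n2 : `|z0.2 - z.2| <= `|z - z0| by rewrite nE distrC le_max lexx orbT.
have B : `|m| * `|w z - w z0| <= `|z - z0| * K + `|z - z0| * K.
  rewrite -normrM E (le_trans (ler_normB _ _)) // !normrM.
  by apply: lerD; apply: ler_pM.
have m4 : 1 / 4 <= `|m| by rewrite ler0_norm; lra.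
have q4 : 0 < 1 / 4 :> R by lra.
rewrite -(ler_pM2l q4); apply: (le_trans (ler_wpM2r (normr_ge0 _) m4)).
apply: (le_trans B); move: (`|z - z0|) => N.
by rewrite le_eqVlt; apply/orP; left; apply/eqP; field.
Qed.

Let is_diff_H s z : I s -> is_diff (s, z) (fun p => H p.1 p.2 : R^o)
  (fun h => h.1 * dH s z + (h.2.1 * d s - h.2.2 * b s)).
Proof.
move=> Is.
have D1 h : smooth1 I h -> is_diff (s, z) (fun p : R^o * (R^o * R^o) => h p.1 : R^o)
    (fun y => derive1 h s * y.1).
  move=> sh; apply: (is_diff_comp1 (g := fst) (p := (s, z))); first exact: sh 0%N _ Is.
  exact: is_diff_fst.
have DPs : is_diff (s, z) (fun p : R^o * (R^o * R^o) => P p.1 : R^o)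
    (fun y => derive1 P s * y.1).
  apply: (is_diff_comp1 (g := fst) (p := (s, z))); last exact: is_diff_fst.
  by have [] := DP Is.
have D21 : is_diff (s, z) (fun p : R^o * (R^o * R^o) => p.2.1) (fun h => h.2.1).
  exact: (is_diff_comp (is_diff_snd (s, z)) (is_diff_fst z)).
have D22 : is_diff (s, z) (fun p : R^o * (R^o * R^o) => p.2.2) (fun h => h.2.2).
  exact: (is_diff_comp (is_diff_snd (s, z)) (is_diff_snd z)).
have EP : derive1 P s = dP s by have [_] := DP Is; rewrite derive1E.
apply: (is_diff_eq (is_diffB (is_diffB (is_diffM D21 (D1 _ sd)) (is_diffM D22 (D1 _ sb))) DPs)).
apply/funext => h; rewrite !fctE /= EP /dH /GRing.scale /=.
by move: (dP s) (derive1 d s) (derive1 b s) => ? ? ?; ring.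
Qed.

Let is_diff_w z : V z -> is_diff z w
  (fun h => - (dH (w z) z)^-1 * (h.1 * d (w z) - h.2 * b (w z))).
Proof.
move=> Vz; have := is_diff_H z (wI Vz).
move=> /is_diff_implicit D.
have [sz _ _] := Vz; have dHn := dH_neg (w_r Vz) sz.
apply: (is_diff_eq (D (8 * K) _ _ _)).
- by rewrite /= !mul0r subr0 addr0 mul1r; apply/eqP => E; move: dHn; rewrite E; lra.
- by apply: (near_open V_open Vz) => z' Vz'; have [] := wP Vz'.
- by apply: (near_open V_open Vz) => z' Vz'; exact: w_lip.
by apply/funext => h; rewrite /= !mul0r subr0 addr0 mul1r add0r.
Qed.

(** The implicit derivative is a quotient whose denominator [dH] is bounded away from 0 on [V], so
    it stays in the algebra. *)
Let Dw v : exists2 g, implicit_algebra I V w g & forall z, V z -> 'D_v w z = g z.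
Proof.
have A h : smooth1 I h -> implicit_algebra I V w (fun z => h (w z)).
  exact: alg_comp.
have A1 h : smooth1 I h -> implicit_algebra I V w (fun z => derive1 h (w z)).
  by move=> sh; apply: alg_comp; exact: smooth1_derive1.
have AN f : implicit_algebra I V w f -> implicit_algebra I V w (cst (-1) * f).
  by move=> Sf; apply: alg_mul Sf; exact: alg_cst.
have AH : implicit_algebra I V w (fun z => dH (w z) z).
  have -> : (fun z => dH (w z) z) = fst * (fun z => derive1 d (w z))
      + cst (-1) * (snd * (fun z => derive1 b (w z)))
      + cst (-1) * ((fun z => derive1 a (w z)) * (fun z => d (w z))
        + (fun z => a (w z)) * (fun z => derive1 d (w z))
        + cst (-1) * ((fun z => derive1 c (w z)) * (fun z => b (w z))
        + (fun z => c (w z)) * (fun z => derive1 b (w z)))).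
    by apply/funext => z; rewrite !fctE /= /dH /dP; ring.
  exact: (alg_add
    (alg_add (alg_mul (alg_fst _ _ _) (A1 _ sd)) (AN _ (alg_mul (alg_snd _ _ _) (A1 _ sb))))
    (AN _ (alg_add
      (alg_add (alg_mul (A1 _ sa) (A _ sd)) (alg_mul (A _ sa) (A1 _ sd)))
      (AN _ (alg_add (alg_mul (A1 _ sc) (A _ sb)) (alg_mul (A _ sc) (A1 _ sb))))))).
exists (cst (-1) * (fun z => (dH (w z) z)^-1) *
    (cst v.1 * (fun z => d (w z)) + cst (- v.2) * (fun z => b (w z)))).
  apply: alg_mul.
    apply: (AN); apply: alg_inv AH _ => z Vz; have [sz _ _] := Vz.
    by apply/eqP => E; have := dH_neg (w_r Vz) sz; rewrite E; lra.
  exact: (alg_add (alg_mul (alg_cst _ _ _ _) (A _ sd)) (alg_mul (alg_cst _ _ _ _) (A _ sb))).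
move=> z Vz; have [dw Ew] := is_diff_w Vz.
rewrite deriveE // Ew !fctE /=.
by move: (dH _ _) => D; ring.
Qed.

(** The second component solves c s + y d s = z.2 for y at s = w z. *)
Let phi z : R^o * R^o := (w z, (z.2 - c (w z)) / d (w z)).
(** The bound on q.1 keeps it in the interval where the root is unique, so that [phi] recovers q and
    not another preimage. *)
Let U := [set q : R^o * R^o | `|q.1 - u| < r /\
  V (ruled_scalar a b q, ruled_scalar c d q)].

Let d_neq0 s : `|s - u| <= r -> d s != 0.
Proof. by move=> /region [_ ds _ _]; apply/eqP => E; move: ds; rewrite E; lra. Qed.

Let U_open : open U.
Proof.
rewrite openE => q [qr Vq].
have Iq : I q.1 by have [] := region (ltW qr).
have C h k : smooth1 I h -> smooth1 I k -> ruled_scalar h k @ q --> ruled_scalar h k q.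
  move=> sh sk; apply: differentiable_continuous.
  by have [] := is_diff_ruled (sh 0%N _ Iq) (sk 0%N _ Iq).
have N1 : \forall q' \near q, `|q'.1 - u| < r.
  have F : (fun q' : R^o * R^o => `|q'.1 - u|) @ q --> `|q.1 - u|.
    by apply: cvg_norm; apply: cvgB; [exact: cvg_fst|exact: cvg_cst].
  exact: (cvgr_lt _ F).
have N2 : \forall q' \near q, V (ruled_scalar a b q', ruled_scalar c d q').
  have F := @cvg_pair _ _ _ _ _ _ _ _ _ _ _ (C a b sa sb) (C c d sc sd).
  exact: (F _ _ _ V (open_nbhs_nbhs (conj V_open Vq))).
exact: filterI.
Qed.

Lemma ruled_local_inverse_of_root : ruled_local_inverse_stmt.
Proof.
have g_phi z : V z -> (ruled_scalar a b (phi z), ruled_scalar c d (phi z)) = z.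
  move=> Vz; have [_ Hz] := wP Vz; have dn := d_neq0 (w_r Vz).
  rewrite [RHS]surjective_pairing /ruled_scalar /=; congr pair; last by field.
  apply: (mulIf dn); move: Hz; rewrite /H /P => Hz.
  transitivity (z.1 * d (w z) - 0); last by rewrite subr0.
  by rewrite -Hz; field.
exists U, V, phi; split; [|split].
- split; first exact: U_open.
    split => /=; first by rewrite subrr normr0.
    by rewrite /ruled_scalar /= au bu cu du mulr0 addr0 mulr1 addNr.
  by move=> q [qr _]; have [] := region (ltW qr).
- split; [exact: V_open|exact: V0|move=> h k sh sk].
  apply: (implicit_algebra_smooth V_open wI _ Dw); first by move=> z /is_diff_w [].
  have -> : (fun z => ruled_scalar h k (phi z)) = (fun z => h (w z)) +
      ((snd + cst (-1) * (fun z => c (w z))) * (fun z => (d (w z))^-1)) * (fun z => k (w z)).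
    by apply/funext => z; rewrite !fctE /= /ruled_scalar /= mulN1r.
  apply: alg_add; first exact: alg_comp.
  apply: alg_mul; last exact: alg_comp.
  apply: alg_mul; last by apply: alg_inv; [exact: alg_comp|move=> z /w_r /d_neq0].
  apply: alg_add; first exact: alg_snd.
  by apply: alg_mul; [exact: alg_cst|exact: alg_comp].
split; last first.
  move=> z Vz; split; last exact: g_phi.
  by split; [have [] := wP Vz|rewrite g_phi].
move=> q [qr Vq]; split => //.
set z := (ruled_scalar a b q, ruled_scalar c d q) in Vq *.
have [sz _ _] := Vq; have [_ Hz] := wP Vq.
(* Eliminating y makes q.1 a root of H for the image z of q, and uniqueness identifies it with w
   z. *)
have wq : w z = q.1.
  apply: (root_uniq sz (w_r Vq) (ltW qr) Hz).
  by rewrite /H /P /z /ruled_scalar /=; ring.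
rewrite [RHS]surjective_pairing /phi wq; congr pair.
by rewrite /z /ruled_scalar /=; field; exact: d_neq0 (ltW qr).
Qed.

End root.

Lemma ruled_local_inverse_of_region : ruled_local_inverse_stmt.
Proof. by have [w wP] := root_ex; exact: ruled_local_inverse_of_root wP. Qed.

End region.

Lemma ruled_local_inverse :
  exists (U V : set (R^o * R^o)) (phi : R^o * R^o -> R^o * R^o),
  [/\ open U, U (u, t) & forall q, U q -> I q.1] /\
  [/\ open V, V (0, 0) & forall h k, smooth1 I h -> smooth1 I k ->
       smooth_on V (fun z => ruled_scalar h k (phi z))] /\
  [/\ forall q, U q -> V (ruled_scalar a b q, ruled_scalar c d q) /\
         phi (ruled_scalar a b q, ruled_scalar c d q) = q &
      forall z, V z -> U (phi z) /\
         (ruled_scalar a b (phi z), ruled_scalar c d (phi z)) = z].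
Proof.
have [[r K] /= r0 region] := near_region.
exact: (ruled_local_inverse_of_region r0 region).
Qed.

End local_inverse.

(** * Existence of a Monge form *)

Section existence.
Variable R : realType.

Lemma entry4_inj (v w : 'cV[R]_4) : (forall k, (k < 4)%N -> entry4 v k = entry4 w k) -> v = w.
Proof.
by move=> H; apply/colP => i; have := H i (ltn_ord i); rewrite /entry4 inord_val.
Qed.

Lemma entry4_invmx_row (a b c d : 'cV[R]_4) (k : nat) : (k < 4)%N ->
  det4 a b c d != 0 ->
  let M := invmx (row_mx a (row_mx b (row_mx c d)) : 'M[R]_4) in
  entry4 (M *m a) k = (k == 0%N)%:R /\ entry4 (M *m b) k = (k == 1%N)%:R.
Proof.
move=> k4 D M.
have : M *m (row_mx a (row_mx b (row_mx c d)) : 'M[R]_4) = 1%:M.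
  by rewrite mulVmx // unitmxE unitfE.
have -> : M *m (row_mx a (row_mx b (row_mx c d)) : 'M[R]_4) =
    row_mx (M *m a) (row_mx (M *m b) (row_mx (M *m c) (M *m d))).
  by rewrite -!mul_mx_row.
rewrite row_mx4E => /matrixP H.
have := H (inord k) (inord 0); have := H (inord k) (inord 1).
by rewrite !mxE !inordK //= => -> ->; rewrite -!val_eqE /= !inordK.
Qed.

(** In the basis F_u, e, e', w the Jacobian of the first two coordinates at (u, t) is the identity,
    which is the normalisation the local inverse requires; the other two coordinates composed with
    that inverse are the Monge functions. *)
Lemma monge_form_exists (I : set R) (x e : R -> 'cV[R]_4) (u t : R) :
  open I ->
  smooth_on (I : set R^o) (x : R^o -> 'cV[R]_4) ->
  smooth_on (I : set R^o) (e : R^o -> 'cV[R]_4) ->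
  I u -> free [:: derive1 x u; e u; derive1 e u] ->
  exists B f1 f2,
    monge_form [set q : R^o * R^o | I q.1] (ruled x e) (u, t) B f1 f2.
Proof.
move=> oI sx se Iu fr.
have [w w0] := free_det4_extend fr.
pose Fu := derive1 x u + t *: derive1 e u.
have D : det4 Fu (e u) (derive1 e u) w != 0 by rewrite det4_shear.
pose B : 'M[R]_4 := row_mx Fu (row_mx (e u) (row_mx (derive1 e u) w)).
pose M := invmx B.
have uB : B \in unitmx by rewrite unitmxE unitfE.
have MFu k : (k < 4)%N -> entry4 (M *m Fu) k = (k == 0%N)%:R.
  by move=> k4; have [] := entry4_invmx_row k4 D.
have Me k : (k < 4)%N -> entry4 (M *m e u) k = (k == 1%N)%:R.
  by move=> k4; have [] := entry4_invmx_row k4 D.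
pose P := ruled x e (u, t).
pose A k := coordx x M P k; pose E k := coorde e M k.
have sA k : smooth1 I (A k) by exact: smooth1_coordx.
have sE k : smooth1 I (E k) by exact: smooth1_coorde.
have g0 k : ruled_scalar (A k) (E k) (u, t) = 0.
  by rewrite ruled_scalar_coord subrr mulmx0 /entry4 mxE.
have dFu k : (k < 4)%N -> derive1 (A k) u + t * derive1 (E k) u = (k == 0%N)%:R.
  move=> k4; rewrite -MFu // entry4_mulmxDZ; congr (_ + t * _).
    exact: (derive1n_coordx M P oI sx k 0 Iu).
  exact: (derive1n_coorde M oI se k 1 Iu).
have Eu k : (k < 4)%N -> E k u = (k == 1%N)%:R by exact: Me.
have Au k : A k u = - (t * E k u) by apply/eqP; rewrite -addr_eq0; apply/eqP/g0.
have E0 : E 0%N u = 0 by exact: Eu.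
have E1 : E 1%N u = 1 by exact: Eu.
have A0 : A 0%N u = 0 by rewrite Au E0 mulr0 oppr0.
have A1 : A 1%N u = - t by rewrite Au E1 mulr1.
have [U [V [phi [[oU U0 UI] [[oV V0 sphi] [gU phiV]]]]]] :=
  ruled_local_inverse oI Iu (sA 0%N) (sE 0%N) (sA 1%N) (sE 1%N) E0 E1 A0 A1 (dFu 0%N isT).
pose f k z := ruled_scalar (A k) (E k) (phi z).
have phi0 : phi (0, 0) = (u, t) by have [_] := gU _ U0; rewrite !g0.
have sf k : smooth_on V (f k) by exact: sphi.
have Df k v : 'D_v (ruled_scalar (A k) (E k)) (u, t) =
    v.1 * (derive1 (A k) u + t * derive1 (E k) u) + v.2 * E k u.
  exact: (derive_ruled (q := (u, t)) v (sA k 0%N u Iu) (sE k 0%N u Iu)).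
have j1 k : (1 < k < 4)%N -> j1_zero (f k).
  move=> /andP[k1 k4].
  have kE : (k == 0%N) = false /\ (k == 1%N) = false.
    by split; apply: gtn_eqF => //; exact: ltn_trans k1.
  (* Differentiating the graph relation at (u, t): the base coordinates have derivative v, and the
     k-th coordinate has derivative 0 because F_u and e are the first two basis vectors. *)
  have Df0 v : v.1 * 'D_(dX R) (f k) (0, 0) + v.2 * 'D_(dY R) (f k) (0, 0) = 0.
    have d2 j : differentiable (ruled_scalar (A j) (E j)) (u, t).
      by have [] := is_diff_ruled (q := (u, t)) (sA j 0%N u Iu) (sE j 0%N u Iu).
    have df : differentiable (f k) (ruled_scalar (A 0%N) (E 0%N) (u, t),
        ruled_scalar (A 1%N) (E 1%N) (u, t)).
      by rewrite !g0; exact: sf k [::] _ V0.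
    have := derive_comp_pair v (d2 0%N) (d2 1%N) df.
    rewrite !Df !g0 E0 E1 (dFu 0%N) // (dFu 1%N) // mulr1 mulr0 mulr0 addr0 mulr1 add0r.
    move=> <-; transitivity ('D_v (ruled_scalar (A k) (E k)) (u, t)).
      apply: near_eq_derive; apply: (near_open oU U0) => q Uq.
      by rewrite /f (gU _ Uq).2.
    by rewrite Df dFu // Eu // kE.1 kE.2 !mulr0 addr0.
  split; first by rewrite /f phi0 g0.
    by have := Df0 (1, 0); rewrite /= mul1r mul0r addr0.
  by have := Df0 (0, 1); rewrite /= mul1r mul0r add0r.
exists B, (f 2%N), (f 3%N); split => //.
exists U, V; split; [by split|split; [by split|split; [|exact: j1|exact: j1]]].
have key q : U q -> ruled x e q = P +
    B *m graph_pt (f 2%N) (f 3%N) (ruled_scalar (A 0%N) (E 0%N) q, ruled_scalar (A 1%N) (E 1%N) q).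
  move=> Uq; rewrite -[LHS](subrK P) addrC; congr (_ + _).
  rewrite -[LHS](mulKVmx uB) -/M; congr (B *m _); apply: entry4_inj => k k4.
  rewrite -ruled_scalar_coord.
  have [G0 G1 G2 G3] := graph_pt_entry4 (f 2%N) (f 3%N)
    (ruled_scalar (A 0%N) (E 0%N) q, ruled_scalar (A 1%N) (E 1%N) q).
  case: k k4 => [_|[_|[_|[_|//]]]].
  - by rewrite G0.
  - by rewrite G1.
  - by rewrite G2 /f (gU _ Uq).2.
  - by rewrite G3 /f (gU _ Uq).2.
apply/seteqP; split=> [_ [q Uq <-]|_ [z Vz <-]].
  by exists (ruled_scalar (A 0%N) (E 0%N) q, ruled_scalar (A 1%N) (E 1%N) q);
    [exact: (gU _ Uq).1|exact: esym (key _ Uq)].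
by have [Up gp] := phiV _ Vz; exists (phi z) => //; rewrite (key _ Up) gp.
Qed.

Lemma affine_eq0 (p q t : R) : q != 0 -> (p + t * q == 0) = (t == - p / q).
Proof. by move=> q0; rewrite addrC addr_eq0 -[RHS](inj_eq (mulIf q0)) divfK. Qed.

End existence.

Theorem proposition2p1 (R : realType) (I : set R) (x e : R -> 'cV[R]_4)
  (I_open : open I) (I_itv : is_interval I) (I0 : I 0)
  (x_smooth : smooth_on (I : set R^o) (x : R^o -> 'cV[R]_4))
  (e_smooth : smooth_on (I : set R^o) (e : R^o -> 'cV[R]_4))
  (e_neq0 : forall u, I u -> e u != 0)
  (nondev : forall u, I u -> free [:: derive1 x u; e u; derive1 e u]) :
  let D := [set q : R^o * R^o | I q.1] in
  let F := ruled x e in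
  (forall u t : R, I u ->
     (parabolic D F (u, t) \/ real_inflection D F (u, t)) /\
     ~ (parabolic D F (u, t) /\ real_inflection D F (u, t))) /\
  (det4 (derive1 x 0) (e 0) (derive1 e 0) (derive1n 2 e 0) != 0 ->
   exists t0 : R,
     (forall t : R, parabolic D F (0, t) <-> t <> t0) /\
     real_inflection D F (0, t0)).
Proof.
move=> D F.
pose Delta u t := det4 (derive1 x u) (e u) (derive1 e u)
  (derive1n 2 x u + t *: derive1n 2 e u).
(* An equivalence is available because the rank formula holds for every Monge form: one direction
   uses it on the given form, the other on a constructed one. *)
have typeE r u t : I u ->
    point_type r D F (u, t) <-> r = if Delta u t == 0 then 1%N else 2%N.
  move=> Iu; split.
    move=> [B [f1 [f2 [l [m [n [a [b [c [[mf j1 j2] [_ _ <-]]]]]]]]]]].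
    by have [_ _ ->] := monge_form_type I_open x_smooth e_smooth Iu (nondev _ Iu) mf j1 j2.
  move=> ->; have [B [f1 [f2 mf]]] :=
    monge_form_exists t I_open x_smooth e_smooth Iu (nondev _ Iu).
  pose hess (f : R^o * R^o -> R^o) v w := 'D_v ('D_w f) (0, 0) / 2.
  have j (f : R^o * R^o -> R^o) : j2_quad f (hess f (dX R) (dX R))
    (hess f (dX R) (dY R)) (hess f (dY R) (dY R)) by [].
  have T := monge_form_type I_open x_smooth e_smooth Iu (nondev _ Iu) mf (j f1) (j f2).
  by exists B, f1, f2; do 6 eexists; split; [split; [exact: mf|exact: j|exact: j]|exact: T].
split=> [u t Iu|D0].
  rewrite /parabolic /real_inflection !typeE //.
  by case: ifP => _; split; [right| case|left|case].
pose d1 := det4 (derive1 x 0) (e 0) (derive1 e 0) (derive1n 2 x 0).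
pose d2 := det4 (derive1 x 0) (e 0) (derive1 e 0) (derive1n 2 e 0).
have DeltaE t : (Delta 0 t == 0) = (t == - d1 / d2).
  by rewrite /Delta det4_linearr affine_eq0.
(* The root of the affine function d1 + t d2, where d2 is nonzero by assumption. *)
exists (- d1 / d2); split=> [t|]; rewrite /parabolic /real_inflection typeE // DeltaE.
  by case: eqP => // H; split.
by rewrite eqxx.
Qed.
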